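(* Let $1\le p<\infty$, let $M_p:=2^{\frac12+\frac1p}$, let $\mathcal{C}(I\times J,\mathbb{R})$ and $\mathcal{C}(I\times J,\mathbb{C})$ be equipped with the $\mathcal{L}^p$-norm, let $\mathcal{F}^{\alpha}=\mathcal{F}^{\alpha}_{\Delta,L}$ be the fractal operator on $\mathcal{C}(I\times J,\mathbb{R})$, and let $\mathcal{F}^{\alpha}_{\mathbb{C}}:\mathcal{C}(I\times J,\mathbb{C})\to\mathcal{C}(I\times J,\mathbb{C})$ be given by $\mathcal{F}^{\alpha}_{\mathbb{C}}(f_1+if_2)=\mathcal{F}^{\alpha}(f_1)+i\,\mathcal{F}^{\alpha}(f_2)$ for $f_1,f_2\in\mathcal{C}(I\times J,\mathbb{R})$. Then there exists a bounded linear operator $\overline{\mathcal{F}}^{\alpha}_{\mathbb{C}}:\mathcal{L}^p(I\times J,\mathbb{C})\to\mathcal{L}^p(I\times J,\mathbb{C})$ whose restriction to $\mathcal{C}(I\times J,\mathbb{C})$ is $\mathcal{F}^{\alpha}_{\mathbb{C}}$ and $$\|\mathcal{F}^{\alpha}\|\le\|\overline{\mathcal{F}}^{\alpha}_{\mathbb{C}}\|=\|\mathcal{F}^{\alpha}_{\mathbb{C}}\|\le M_p\|\mathcal{F}^{\alpha}\|,$$ all operator norms being taken with respect to the $\mathcal{L}^p$-norm.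
   Context: Let $I=[x_0,x_N]$, $J=[y_0,y_M]$ and let $\Delta$ be a net $x_0<x_1<\dots<x_N$, $y_0<y_1<\dots<y_M$, with $N,M$ such that the maps below are contractive (i.e. $N,M\ge 2$). Put $I_i=[x_{i-1},x_i]$ and $J_j=[y_{j-1},y_j]$. For $1\le i\le N$, $u_i:I\to I_i$ is the affine bijection with $u_i(x_0)=x_{i-1}$, $u_i(x_N)=x_i$ if $i$ is odd, and $u_i(x_0)=x_i$, $u_i(x_N)=x_{i-1}$ if $i$ is even. For $1\le j\le M$, $v_j:J\to J_j$ is the affine bijection with $v_j(y_0)=y_{j-1}$, $v_j(y_M)=y_j$ if $j$ is odd, and $v_j(y_0)=y_j$, $v_j(y_M)=y_{j-1}$ if $j$ is even. The scale function $\alpha:I\times J\to\mathbb{R}$ is continuous with $\|\alpha\|_\infty<1$. $L:\mathcal{C}(I\times J,\mathbb{R})\to\mathcal{C}(I\times J,\mathbb{R})$ is a linear operator bounded with respect to the $\mathcal{L}^p$-norm, $L\neq Id$, with $(Lf)(x_i,y_j)=f(x_i,y_j)$ for all $f$ and all $(i,j)\in\{0,N\}\times\{0,M\}$. For $f\in\mathcal{C}(I\times J,\mathbb{R})$, $f^{\alpha}_{\Delta,L}$ is the unique continuous function on $I\times J$ satisfying, for all $1\le i\le N$, $1\le j\le M$ and $(x,y)\in I_i\times J_j$, $$f^{\alpha}_{\Delta,L}(x,y)=f(x,y)+\alpha(x,y)f^{\alpha}_{\Delta,L}\big(u_i^{-1}(x),v_j^{-1}(y)\big)-\alpha(x,y)(Lf)\big(u_i^{-1}(x),v_j^{-1}(y)\big).$$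 The fractal operator is $\mathcal{F}^{\alpha}_{\Delta,L}(f)=f^{\alpha}_{\Delta,L}$; it is linear and bounded with respect to the $\mathcal{L}^p$-norm on $\mathcal{C}(I\times J,\mathbb{R})$. *)

(* Defs.v *)
From HB Require Import structures.
From mathcomp Require Import all_boot all_order all_algebra.
From mathcomp Require Import generic_quotient ring_quotient.
From mathcomp Require Import complex.
From mathcomp Require Import all_classical all_reals all_analysis.
From mathcomp Require Import measurable_realfun.
Set Implicit Arguments.
Unset Strict Implicit.
Unset Printing Implicit Defensive.
Import Order.TTheory GRing.Theory Num.Theory.
Import numFieldNormedType.Exports.
Local Open Scope classical_set_scope.
Local Open Scope ring_scope.
Import ComplexField.Normc.

Local Notation Re := complex.Re.
Local Notation Im := complex.Im.


(* C(K, V) is represented by the extensions by zero of the continuous functions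
   on K to the whole plane, so that equality in [Cont K V] is equality on K. *)
Section continuous_functions.
Variables (R : realType) (K : set (R * R)) (V : numFieldType).

Definition is_cont0 : {pred (R * R -> V^o)} :=
  mem [set f : R * R -> V^o |
    {within K, continuous f} /\ forall z, ~ K z -> f z = 0].

Lemma is_cont0_submod : submod_closed is_cont0.
Proof.
split.
  rewrite inE; split => //=.
  exact: cst_continuous.
move=> a f g; rewrite !inE => -[cf f0] [cg g0]; split => /=.
  move=> z; apply: cvgD; last exact: cg.
  by apply: cvgZl_tmp; exact: cf.
move=> z Kz; change (a *: f z + g z = 0).
by rewrite f0// g0// scaler0 addr0.
Qed.

HB.instance Definition _ :=
  GRing.isSubmodClosed.Build _ _ is_cont0 is_cont0_submod.

Record Cont := MkCont { cfun :> R * R -> V^o; _ : cfun \in is_cont0 }.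
HB.instance Definition _ := [isSub for cfun].
HB.instance Definition _ := [Choice of Cont by <:].
HB.instance Definition _ := [SubChoice_isSubLmodule of Cont by <:].

Lemma ContP (f : Cont) :
  {within K, continuous (f : R * R -> V^o)} /\ forall z, ~ K z -> f z = 0.
Proof. by case: f => f /=; rewrite inE. Qed.

Definition Cont_of (f : R * R -> V^o)
    (cf : {within K, continuous f}) (f0 : forall z, ~ K z -> f z = 0) : Cont :=
  MkCont (mem_set (conj cf f0)).
End continuous_functions.

(* L^p(mu, C), 1 <= p < oo, as the quotient of the p-integrable functions by the
   subspace of those that vanish almost everywhere. *)
Section complex_Lp.
Context d (T : measurableType d) (R : realType).
Variables (mu : {measure set T -> \bar R}) (p : R) (p1 : 1 <= p).

Definition is_Lp of 1 <= p : {pred (T -> R[i]^o)} :=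
  mem [set f : T -> R[i]^o |
    [/\ measurable_fun setT (fun z => Re (f z)),
        measurable_fun setT (fun z => Im (f z)) &
        finite_norm mu p%:E (fun z => normc (f z))]].

Lemma measurable_normc (f : T -> R[i]) :
  measurable_fun setT (fun z => Re (f z)) ->
  measurable_fun setT (fun z => Im (f z)) ->
  measurable_fun setT (fun z => normc (f z)).
Proof.
move=> mr mi.
rewrite (_ : (fun z => _) =
  Num.sqrt \o (fun z => Re (f z) ^+ 2 + Im (f z) ^+ 2)); last first.
  by apply/funext => z /=; case: (f z).
apply: measurableT_comp.
  by apply: continuous_measurable_fun; exact: sqrt_continuous.
by apply: measurable_funD; exact: measurable_funX.
Qed.

Lemma finite_norm_le (f g : T -> R) :
  measurable_fun setT f -> measurable_fun setT g ->
  (forall z, `|f z| <= `|g z|) ->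
  finite_norm mu p%:E g -> finite_norm mu p%:E f.
Proof.
move=> mf mg fg; rewrite /finite_norm; apply: le_lt_trans.
have p0 : 0 <= p by rewrite (le_trans _ p1).
rewrite unlock /=; apply: gt0_ler_poweR.
- by rewrite invr_ge0.
- by rewrite in_itv/= leey integral_ge0.
- by rewrite in_itv/= leey integral_ge0.
apply: ge0_le_integral => //.
- apply/measurable_EFinP.
  apply: (@measurableT_comp _ _ _ _ _ _ (fun x : R => x `^ p)) => //.
  exact: measurableT_comp.
- apply/measurable_EFinP.
  apply: (@measurableT_comp _ _ _ _ _ _ (fun x : R => x `^ p)) => //.
  exact: measurableT_comp.
- by move=> z _; rewrite lee_fin ge0_ler_powR// nnegrE.
Qed.

Lemma is_Lp_submod : submod_closed (is_Lp p1).
Proof.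
split.
  rewrite inE; split => /=; [exact: measurable_cst|exact: measurable_cst|].
  rewrite (_ : (fun z => _) = cst 0); last first.
    by apply/funext => z; rewrite /= expr0n addr0 sqrtr0.
  by apply: finite_norm_cst0; rewrite lee_fin.
move=> a f g; rewrite !inE => -[mrf mif nf] [mrg mig ng].
have mre : measurable_fun setT (fun z => Re ((a *: f + g) z)).
  rewrite (_ : (fun z => _) = (fun z => Re a * Re (f z) - Im a * Im (f z) + Re (g z))).
    apply: measurable_funD => //; apply: measurable_funB; exact: measurable_funM.
  by apply/funext => z; rewrite /GRing.scale /= /GRing.add/=; case: (a) => ? ?; case: (f z) => ? ?; case: (g z).
have mim : measurable_fun setT (fun z => Im ((a *: f + g) z)).
  rewrite (_ : (fun z => _) = (fun z => Re a * Im (f z) + Im a * Re (f z) + Im (g z))).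
    apply: measurable_funD => //; apply: measurable_funD; exact: measurable_funM.
  by apply/funext => z; rewrite /GRing.scale /= /GRing.add/=; case: (a) => ? ?; case: (f z) => ? ?; case: (g z).
split => //.
have mnf := measurable_normc mrf mif.
have mng := measurable_normc mrg mig.
have p1' : (1 <= p%:E)%E by rewrite lee_fin.
have fL : (fun z => normc (f z)) \in Lfun mu p%:E by rewrite !inE; apply/andP; split; rewrite inE.
have gL : (fun z => normc (g z)) \in Lfun mu p%:E by rewrite !inE; apply/andP; split; rewrite inE.
have := (Lfun_submod_closed mu p1').2 (normc a) _ _ fL gL.
rewrite !inE => /andP[]; rewrite !inE => mh nh.
apply: finite_norm_le mh _ nh; first exact: measurable_normc.
move=> z; change (`|normc (a * f z + g z)| <= `|normc a * normc (f z) + normc (g z)|).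
have n0 (w : R[i]) : 0 <= normc w by case: w => ? ?; exact: sqrtr_ge0.
rewrite !ger0_norm// ?addr_ge0 ?mulr_ge0//.
by rewrite -normcM; exact: (@le_normcD R).
Qed.

HB.instance Definition _ :=
  GRing.isSubmodClosed.Build _ _ (is_Lp p1) is_Lp_submod.

Record Lp_fun := MkLp_fun { lpfun :> T -> R[i]^o; _ : lpfun \in is_Lp p1 }.
HB.instance Definition _ := [isSub for lpfun].
HB.instance Definition _ := [Choice of Lp_fun by <:].
HB.instance Definition _ := [SubChoice_isSubLmodule of Lp_fun by <:].

Definition Lp_null : {pred Lp_fun} :=
  mem [set f : Lp_fun | {ae mu, forall z, f z = 0}].

Lemma Lp_null_submod : submod_closed Lp_null.
Proof.
split; first by rewrite inE/=; exact: aeW.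
move=> a f g; rewrite !inE/=; apply: filterS2 => z fz gz.
by change (a * f z + g z = 0); rewrite fz gz mulr0 addr0.
Qed.
HB.instance Definition _ :=
  GRing.isSubmodClosed.Build _ _ Lp_null Lp_null_submod.

Definition Lp : Type := Quotient.quot Lp_null.
HB.instance Definition _ := GRing.Zmodule.on Lp.
HB.instance Definition _ := EqQuotient.on Lp.

Local Open Scope quotient_scope.

Definition Lp_class (f : Lp_fun) : Lp := \pi_Lp f.

Lemma Lp_classP f g : Lp_class f = Lp_class g <-> {ae mu, forall z, f z = g z}.
Proof.
have -> : Lp_class f = Lp_class g <-> f - g \in Lp_null.
  rewrite /Lp_class Quotient.idealrBE; split => [fg|/eqP//].
  exact/eqP.
rewrite inE/=; split; apply: filterS => z.
  by move=> /eqP fg; apply/eqP; rewrite -subr_eq0.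
by move=> fg; change (f z - g z = 0); rewrite fg subrr.
Qed.

Definition Lp_scale (a : R[i]) (u : Lp) : Lp := Lp_class (a *: repr u).

Lemma Lp_class_repr u : Lp_class (repr u) = u.
Proof. exact: reprK. Qed.

Lemma Lp_classD f g : Lp_class (f + g) = Lp_class f + Lp_class g.
Proof. exact: raddfD. Qed.

Lemma Lp_classZ a f : Lp_class (a *: f) = Lp_scale a (Lp_class f).
Proof.
apply/Lp_classP; have /Lp_classP : Lp_class f = Lp_class (repr (Lp_class f)).
  by rewrite Lp_class_repr.
by apply: filterS => z fz; change (a * f z = a * repr (Lp_class f) z); rewrite fz.
Qed.

Lemma Lp_scaleA a b u : Lp_scale a (Lp_scale b u) = Lp_scale (a * b) u.
Proof. by rewrite -[u]Lp_class_repr -!Lp_classZ scalerA. Qed.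

Lemma Lp_scale1 : left_id 1 Lp_scale.
Proof. by move=> u; rewrite -[u]Lp_class_repr -!Lp_classZ scale1r. Qed.

Lemma Lp_scaleDr : right_distributive Lp_scale +%R.
Proof.
move=> a u v; rewrite -[u]Lp_class_repr -[v]Lp_class_repr.
by rewrite -!(Lp_classD, Lp_classZ) scalerDr.
Qed.

Lemma Lp_scaleDl u : {morph Lp_scale^~ u : a b / a + b}.
Proof.
move=> a b; rewrite -[u]Lp_class_repr.
by rewrite -!Lp_classZ -Lp_classD scalerDl.
Qed.

HB.instance Definition _ := GRing.Zmodule_isLmodule.Build R[i] Lp
  Lp_scaleA Lp_scale1 Lp_scaleDr Lp_scaleDl.

Definition Lp_norm (u : Lp) : \bar R :=
  'N[mu]_p%:E [ EFin \o (fun z => normc (repr u z)) ]%E.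

End complex_Lp.
Arguments Lp {d T R} mu {p} p1.
Arguments Lp_norm {d T R mu p p1} u.


Section rect.
Context {R : realType}.
Implicit Types (a b c d : R) (U K : set (R * R)).

Definition rect a b c d : set (R * R) := `[a, b] `*` `[c, d].

Lemma compact_rect a b c d : compact (rect a b c d).
Proof. by apply: compact_setX; exact: segment_compact. Qed.

Lemma measurable_rect a b c d :
  measurable (rect a b c d : set (measurableTypeR R * measurableTypeR R)).
Proof. by apply: measurableX; exact: measurable_itv. Qed.

Lemma open_measurable_plane U :
  open U -> measurable (U : set (measurableTypeR R * measurableTypeR R)).
Proof.
move=> oU.
pose box (q : (rat * rat) * (rat * rat)) : set (R * R) :=
  `]ratr q.1.1, ratr q.1.2[ `*` `]ratr q.2.1, ratr q.2.2[.
pose F q := if `[< box q `<=` U >] then box q else set0.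
have -> : U = \bigcup_q F q.
  apply/seteqP; split => [[s t] Ust|z [q _]]; last first.
    by rewrite /F; case: asboolP => // bU /bU.
  have /nbhs_ballP[e /= e0 eU] : nbhs (s, t) U by exact: open_nbhs_nbhs.
  have rt (r : R) : exists q1 q2 : rat,
      [/\ r - e < ratr q1 :> R, ratr q1 < r :> R, r < ratr q2 :> R &
          ratr q2 < r + e :> R].
    have [|q1] := @rat_in_itvoo R (r - e) r; first by rewrite ltrBlDr ltrDl.
    have [|q2] := @rat_in_itvoo R r (r + e); first by rewrite ltrDl.
    by rewrite !in_itv/= => /andP[? ?] /andP[? ?]; exists q1, q2.
  have [q1 [q2 [s1 s2 s3 s4]]] := rt s.
  have [q3 [q4 [t1 t2 t3 t4]]] := rt t.
  exists ((q1, q2), (q3, q4)) => //; rewrite /F; case: asboolP => [_|].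
    by split; rewrite /= in_itv/=; apply/andP.
  case=> -[u v] [/=]; rewrite !in_itv/= => /andP[u1 u2] /andP[v1 v2].
  apply: eU; split; rewrite /ball /= ltr_distlC; apply/andP; split.
  - exact: lt_trans u1.
  - exact: lt_trans s4.
  - exact: lt_trans v1.
  - exact: lt_trans t4.
apply: countable_bigcupT_measurable => [|q].
  exact: countableP.
rewrite /F; case: asboolP => // _.
by apply: measurableX; exact: measurable_itv.
Qed.

(* Lebesgue measure on the Borel sets of the plane, restricted to [rect a b c d].
   Borel sets suffice, as every Lebesgue measurable function is equal almost
   everywhere to a Borel one. *)
Definition rect_measure a b c d :
    set (measurableTypeR R * measurableTypeR R) -> \bar R :=
  mrestr (lebesgue_measure \x lebesgue_measure)%E (measurable_rect a b c d).

HB.instance Definition _ a b c d := Measure.on (rect_measure a b c d).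

Lemma rect_measure_lty a b c d : (rect_measure a b c d setT < +oo)%E.
Proof.
rewrite /rect_measure /mrestr setTI /=.
rewrite product_measure1E; [|exact: measurable_itv..].
rewrite /= lte_mul_pinfty// ?lebesgue_measure_itv/=; case: ifPn => //= _;
  by rewrite ?ltry.
Qed.


Lemma Cont_measurable K (f : Cont K R) :
  measurable (K : set (measurableTypeR R * measurableTypeR R)) ->
  measurable_fun (setT : set (measurableTypeR R * measurableTypeR R)) f.
Proof.
have [cf f0] := ContP f => mK.
have -> : cfun f = f \_ K.
  apply/funext => z; rewrite patchE; case: ifPn => //.
  by rewrite notin_setE => /f0.
apply/(@measurable_restrict _ _ _ _ _ setT) => //; rewrite setTI.
apply: (measurability _ (RGenOpens.measurableE R)).
move=> _ [_ [a [b ->] <-]].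
have oab := (continuousP _).1 cf _ (@interval_open _ (BRight a) (BLeft b) isT isT).
case: ((@open_subspaceP _ K _).1 oab) => V oV VD.
rewrite setIC -VD; apply: measurableI => //; exact: open_measurable_plane.
Qed.

Lemma Re_continuous : continuous (@Re R : (R[i] : numFieldType)^o -> R^o).
Proof.
move=> z; apply/(@cvgrPdist_lt _ R^o _ _ (nbhs_filter z)) => e e0.
have ec0 : 0 < (e%:C)%C by rewrite ltcR.
have := @nbhsx_ballx R[i] (R[i]^o) z (e%:C)%C ec0.
apply: filterS => w; rewrite -ball_normE /= -ltcR; apply: le_lt_trans.
by rewrite -raddfB; exact: normc_ge_Re.
Qed.

Lemma Im_continuous : continuous (@Im R : (R[i] : numFieldType)^o -> R^o).
Proof.
move=> z; apply/(@cvgrPdist_lt _ R^o _ _ (nbhs_filter z)) => e e0.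
have ec0 : 0 < (e%:C)%C by rewrite ltcR.
have := @nbhsx_ballx R[i] (R[i]^o) z (e%:C)%C ec0.
apply: filterS => w; rewrite -ball_normE /= -ltcR; apply: le_lt_trans.
rewrite -raddfB/= !normc_def lecR /= -sqrtr_sqr ler_sqrt ?lerDr ?sqr_ge0//.
by rewrite addr_ge0 ?sqr_ge0.
Qed.

Lemma real_complex_continuous :
  continuous (real_complex R : R^o -> (R[i] : numFieldType)^o).
Proof.
move=> x; apply/(@cvgrPdist_lt _ R[i]^o _ _ (nbhs_filter x)) => -[e i]; rewrite ltcE /= => /andP[/eqP-> e0].
have := @nbhsx_ballx R (R^o) x e e0.
apply: filterS => w; rewrite -ball_normE /= -ltcR; apply: le_lt_trans.
by rewrite -rmorphB normc_def /= expr0n addr0 sqrtr_sqr.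
Qed.
End rect.

Section complexification.
Variables (R : realType) (K : set (R * R)).

Lemma Cont_Re_proof (f : Cont K R[i]) :
  {within K, continuous (fun z => Re (f z) : R^o)} /\
  forall z, ~ K z -> Re (f z) = 0.
Proof.
have [cf f0] := ContP f; split=> [z|z /f0 ->//].
by apply: (@continuous_comp (subspace K) R[i]^o R^o f (@Re R) z); [exact: cf|exact: Re_continuous].
Qed.
Definition Cont_Re f := Cont_of (Cont_Re_proof f).1 (Cont_Re_proof f).2.

Lemma Cont_Im_proof (f : Cont K R[i]) :
  {within K, continuous (fun z => Im (f z) : R^o)} /\
  forall z, ~ K z -> Im (f z) = 0.
Proof.
have [cf f0] := ContP f; split=> [z|z /f0 ->//].
by apply: (@continuous_comp (subspace K) R[i]^o R^o f (@Im R) z); [exact: cf|exact: Im_continuous].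
Qed.
Definition Cont_Im f := Cont_of (Cont_Im_proof f).1 (Cont_Im_proof f).2.

Lemma Cont_complex_proof (g h : Cont K R) :
  {within K, continuous (fun z => (g z +i* h z)%C : R[i]^o)} /\
  forall z, ~ K z -> (g z +i* h z)%C = 0.
Proof.
have [cg g0] := ContP g; have [ch h0] := ContP h; split; last first.
  by move=> z Kz; rewrite g0// h0.
rewrite (_ : (fun z => _) =
    (fun z => (g z)%:C%C + ('i%C : R[i]) *: ((h z)%:C%C : R[i]^o))); last first.
  by apply/funext => z; exact: complexE.
move=> z; apply: cvgD.
  apply: (@continuous_comp (subspace K) R^o R[i]^o g (real_complex R) z); [exact: cg|].
  exact: real_complex_continuous.
apply: cvgZl_tmp.
apply: (@continuous_comp (subspace K) R^o R[i]^o h (real_complex R) z); [exact: ch|].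
exact: real_complex_continuous.
Qed.
Definition Cont_complex g h :=
  Cont_of (Cont_complex_proof g h).1 (Cont_complex_proof g h).2.

Definition complexify (F : Cont K R -> Cont K R) (f : Cont K R[i]) :
    Cont K R[i] :=
  Cont_complex (F (Cont_Re f)) (F (Cont_Im f)).
End complexification.

Section embed.
Variables (R : realType) (a b c d : R) (p : R) (p1 : 1 <= p).
Local Notation K := (rect a b c d).
Local Notation mu := (rect_measure a b c d).

Lemma Cont_bounded (f : Cont K R) : exists M : R, forall z, `|f z : R| <= M.
Proof.
have [cf f0] := ContP f.
have cK : compact (f @` K : set R^o).
  by apply: continuous_compact => //; exact: compact_rect.
have := compact_bounded cK.
move=> -[M [Mr MP]]; exists (`|M| + 1) => z.
have [Kz|Kz] := pselect (K z); last by rewrite f0// normr0 addr_ge0.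
apply: MP; last by exists z.
by rewrite (le_lt_trans (ler_norm _))// ltrDl.
Qed.

Lemma Cont_is_Lp (f : Cont K R[i]) : (f : R * R -> R[i]^o) \in is_Lp mu p1.
Proof.
have mR := Cont_measurable (Cont_Re f) (measurable_rect a b c d).
have mI := Cont_measurable (Cont_Im f) (measurable_rect a b c d).
rewrite inE; split => //=.
have [M1 M1P] := Cont_bounded (Cont_Re f).
have [M2 M2P] := Cont_bounded (Cont_Im f).
apply: (@finite_norm_le _ _ _ _ _ p1 _ (cst (M1 + M2))) => //.
- exact: measurable_normc.
- move=> z /=; have := M1P z; have := M2P z; rewrite /=.
  case: (f z) => u v /= vM uM.
  rewrite !ger0_norm ?sqrtr_ge0 ?addr_ge0 ?(le_trans _ vM) ?(le_trans _ uM)//.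
  apply: le_trans (lerD uM vM).
  rewrite -[leRHS]ger0_norm ?addr_ge0// -sqrtr_sqr ler_sqrt ?sqr_ge0//.
  by rewrite sqrrD !real_normK ?num_real// addrAC lerDl mulrn_wge0 ?mulr_ge0.
rewrite /finite_norm unlock poweR_lty//.
under eq_integral => z _ do rewrite /comp /cst abse_EFin poweR_EFin.
rewrite integral_cst//= lte_mul_pinfty ?lee_fin ?powR_ge0//.
exact: rect_measure_lty.
Qed.

Definition Cont_normR (f : Cont K R) : \bar R := 'N[mu]_p%:E [ EFin \o f ]%E.

Definition Cont_normC (f : Cont K R[i]) : \bar R :=
  'N[mu]_p%:E [ EFin \o (fun z => normc (f z)) ]%E.

Definition Cont_Lp (f : Cont K R[i]) : Lp mu p1 :=
  Lp_class (MkLp_fun (Cont_is_Lp f)).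
End embed.
Arguments Cont_normR {R a b c d} p f.
Arguments Cont_normC {R a b c d} p f.
Arguments Cont_Lp {R a b c d p} p1 f.

Section operators.
Variables (R : realType) (U V : Type).
Variables (nU : U -> \bar R) (nV : V -> \bar R) (A : U -> V).

Definition bounded_op : Prop :=
  exists M : R, forall u, (nV (A u) <= M%:E * nU u)%E.

Definition opnorm : \bar R :=
  ereal_sup [set nV (A u) | u in [set u | nU u <= 1]%E].
End operators.

Definition supnorm (R : realType) (K : set (R * R)) (f : Cont K R) : \bar R :=
  ereal_sup [set `|f z|%:E | z in K].

Section net_maps.
Variable R : realType.
Implicit Types (x : nat -> R) (N i : nat) (r s t : R).

(* the affine map that sends s to s' and t to t' *)
Definition affine_map s t s' t' r : R := s' + (t' - s') / (t - s) * (r - s).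

Lemma affine_mapK s t s' t' : s != t -> s' != t' ->
  cancel (affine_map s t s' t') (affine_map s' t' s t).
Proof.
move=> st st' r; rewrite /affine_map addrAC subrr add0r !mulrA.
rewrite mulfVK ?subr_eq0 1?eq_sym// divff ?subr_eq0 1?eq_sym// mul1r.
by rewrite addrC subrK.
Qed.

(* The map u_i from [x 0, x N] onto [x (i - 1), x i], and its inverse. *)
Definition net_map x N i : R -> R :=
  if odd i then affine_map (x 0%N) (x N) (x i.-1) (x i)
  else affine_map (x 0%N) (x N) (x i) (x i.-1).

Definition net_inv x N i : R -> R :=
  if odd i then affine_map (x i.-1) (x i) (x 0%N) (x N)
  else affine_map (x i) (x i.-1) (x 0%N) (x N).

Lemma net_mapK x N i : x 0%N != x N -> x i.-1 != x i ->
  cancel (net_map x N i) (net_inv x N i).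
Proof.
by move=> xN xi; rewrite /net_map /net_inv; case: ifP => _;
  apply: affine_mapK; rewrite // eq_sym.
Qed.

Lemma net_invK x N i : x 0%N != x N -> x i.-1 != x i ->
  cancel (net_inv x N i) (net_map x N i).
Proof.
by move=> xN xi; rewrite /net_map /net_inv; case: ifP => _;
  apply: affine_mapK; rewrite // eq_sym.
Qed.
End net_maps.

Notation net_rect x N y M := (rect (x 0%N) (x N) (y 0%N) (y M)).
Notation net_measure x N y M := (rect_measure (x 0%N) (x N) (y 0%N) (y M)).

Section fractal_operator.
Variables (R : realType) (x : nat -> R) (N : nat) (y : nat -> R) (M : nat).
Local Notation K := (net_rect x N y M).
Variables (alpha : Cont K R) (L : Cont K R -> Cont K R).

Definition is_alpha_fractal (f g : Cont K R) : Prop :=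
  forall i j, (1 <= i <= N)%N -> (1 <= j <= M)%N ->
  forall s t, x i.-1 <= s <= x i -> y j.-1 <= t <= y j ->
  g (s, t) = f (s, t)
    + alpha (s, t) * g (net_inv x N i s, net_inv y M j t)
    - alpha (s, t) * L f (net_inv x N i s, net_inv y M j t).

(* For a strictly increasing net and [supnorm alpha < 1] there is exactly one g
   with [is_alpha_fractal f g]; the default 0 is never used. *)
Definition fractal_op (f : Cont K R) : Cont K R :=
  xget 0 [set g | is_alpha_fractal f g].
End fractal_operator.
Arguments is_alpha_fractal {R} x N y M alpha L f g.
Arguments fractal_op {R} x N y M alpha L f.

(* Main.v *)
Require Import Defs.
From HB Require Import structures.
From mathcomp Require Import all_boot all_order all_algebra.
From mathcomp Require Import complex.
From mathcomp Require Import all_classical all_reals all_analysis.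
From mathcomp Require Import measurable_realfun lra ring.
Set Implicit Arguments.
Unset Strict Implicit.
Unset Printing Implicit Defensive.
Import Order.TTheory GRing.Theory Num.Theory.
Import numFieldNormedType.Exports.
Import ComplexField.Normc.
Local Open Scope classical_set_scope.
Local Open Scope ring_scope.

(** Why the theorem holds.

    Let [phi] be the map of the rectangle onto itself that inverts every cell
    map [(u_i, v_j)] on its own cell. Since neighbouring cells are reflected
    into each other, the inverses agree on common edges, so that [phi] is a
    continuous folding map, and [f^alpha] is the fixed point of the
    contraction [g |-> f - alpha . (L f o phi) + alpha . (g o phi)]
    ([fractal_opP], [fractal_op_uniq]); linearity of the fractal operator
    follows from uniqueness of the fixed point. In each coordinate a cell is
    mapped affinely onto the whole interval, so it carries exactly its share of
    the mass of the image: [phi] preserves Lebesgue measure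
    ([net_measure_fold_map2]) and composition with [phi] is an L^p isometry.
    With [q] the supremum of [|alpha|] and [C] an L^p bound of [L], the fixed
    point equation gives
    [||f^alpha|| <= ||f|| + q C ||f|| + q ||f^alpha||], hence boundedness
    ([fractal_op_bounded]).

    The complexification is then bounded because
    [(s^2 + t^2)^(p/2) <= 2^(p/2) (|s|^p + |t|^p)], and
    [||f_1||, ||f_2|| <= ||f_1 + i f_2||]: integrating gives the factor
    [2^(1/2) 2^(1/p)] ([Cont_normC_complex]).

    What remains is the extension of a bounded operator from [C(K, C)] to
    [L^p(K, C)] with the same norm ([bounded_linear_extension]). It needs two
    classical facts. Completeness of L^p is the Riesz-Fischer theorem
    ([Lp_nrm_complete]), obtained from Fatou's lemma. Density of the
    continuous functions ([Cont_Lp_dense]) is reduced to indicators of Borel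
    sets; the Borel sets whose indicator agrees with a continuous function off
    a set of small measure form a sigma-algebra containing the preimages of
    rays by the two projections, hence all Borel sets. The norm of the
    extension equals that of the complexification, and real functions embed
    isometrically as [f + i 0], which gives the lower bound. *)

Local Notation Re := complex.Re.
Local Notation Im := complex.Im.

(** * The modulus of a complex number *)

Section normc_facts.
Variable R : rcfType.
Implicit Types v w : R[i].

Lemma normc_ge0 v : 0 <= normc v.
Proof. by case: v => a b; exact: sqrtr_ge0. Qed.

Lemma normr_Re_le v w : `|Re v - Re w| <= normc (v - w).
Proof.
case: v w => a b [a' b'] /=.
by rewrite -sqrtr_sqr ler_sqrt ?addr_ge0 ?sqr_ge0// lerDl sqr_ge0.
Qed.

Lemma normr_Im_le v w : `|Im v - Im w| <= normc (v - w).
Proof.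
case: v w => a b [a' b'] /=.
by rewrite -sqrtr_sqr ler_sqrt ?addr_ge0 ?sqr_ge0// lerDr sqr_ge0.
Qed.

Lemma normr_Re v : `|Re v| <= normc v.
Proof. by have := normr_Re_le v 0; rewrite !subr0. Qed.

Lemma normr_Im v : `|Im v| <= normc v.
Proof. by have := normr_Im_le v 0; rewrite !subr0. Qed.

Lemma normcB_E v w :
  normc (v - w) = Num.sqrt ((Re v - Re w) ^+ 2 + (Im v - Im w) ^+ 2).
Proof. by case: v w => a b [a' b']. Qed.

Lemma normcB_le v w :
  normc (v - w) <= `|Re v - Re w| + `|Im v - Im w|.
Proof.
rewrite normcB_E; set s := Re v - _; set t := Im v - _.
rewrite -[leRHS]ger0_norm ?addr_ge0// -(sqrtr_sqr (_ + _)) ler_sqrt ?sqr_ge0//.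
by rewrite [leRHS]sqrrD !real_normK ?num_real// addrAC lerDl mulrn_wge0 ?mulr_ge0.
Qed.
End normc_facts.

(** * Extension of a bounded linear map from a dense subspace *)

Section bounded_linear_extension.
Variables (R : realType) (C W : lmodType R[i]) (nrm : W -> R).
Hypothesis nrmD : forall u v, nrm (u + v) <= nrm u + nrm v.
Hypothesis nrmZ : forall a u, nrm (a *: u) = normc a * nrm u.
Hypothesis nrm_eq0 : forall u, nrm u = 0 -> u = 0.
Hypothesis nrm_complete : forall u_ : nat -> W,
  (forall n, nrm (u_ n.+1 - u_ n) <= 2^-1 ^+ n) ->
  exists u, forall n, nrm (u - u_ n) <= 2 * 2^-1 ^+ n.
Variables (iota T : {linear C -> W}) (k : R).
Hypothesis iota_dense : forall w e, 0 < e -> exists c, nrm (w - iota c) < e.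
Hypothesis k0 : 0 <= k.
Hypothesis T_bounded : forall c, nrm (T c) <= k * nrm (iota c).

Let nrm0 : nrm 0 = 0.
Proof. by rewrite -(scale0r 0) nrmZ normc0 mul0r. Qed.

Let nrmN u : nrm (- u) = nrm u.
Proof. by rewrite -scaleN1r nrmZ normcN normc1 mul1r. Qed.

Let nrmB u v : nrm (u - v) = nrm (v - u).
Proof. by rewrite -nrmN opprB. Qed.

Let nrm_ge0 u : 0 <= nrm u.
Proof. by have := nrmD u (- u); rewrite subrr nrm0 nrmN -mulr2n pmulrn_lge0. Qed.

(** The extension is the closure of the graph of [T] over [iota]: density makes
    this relation total, boundedness makes it functional. *)
Definition closed_graph (w v : W) : Prop :=
  forall e, 0 < e -> exists c, nrm (w - iota c) < e /\ nrm (v - T c) < e.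

Let closed_graph_linear a w v w' v' : closed_graph w v -> closed_graph w' v' ->
  closed_graph (a *: w + w') (a *: v + v').
Proof.
move=> wv wv' e e0.
have na : 0 < normc a + 1 by rewrite ltr_wpDl// normc_ge0.
have [|c [cw cv]] := wv (e / 2 / (normc a + 1)).
  by rewrite divr_gt0// divr_gt0.
have [|c' [cw' cv']] := wv' (e / 2); first by rewrite divr_gt0.
have step u u' t t' : nrm (u - t) < e / 2 / (normc a + 1) ->
    nrm (u' - t') < e / 2 -> nrm (a *: u + u' - (a *: t + t')) < e.
  move=> ut ut'; rewrite opprD addrACA -scalerBr (splitr e).
  apply: (le_lt_trans (nrmD _ _)); rewrite nrmZ ler_ltD//.
  apply: (@le_trans _ _ ((normc a + 1) * nrm (u - t))).
    by rewrite ler_wpM2r// lerDl.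
  by rewrite mulrC -ler_pdivlMr// ltW.
by exists (a *: c + c'); split; rewrite linearP; exact: step.
Qed.

Let closed_graph_bounded w v : closed_graph w v -> nrm v <= k * nrm w.
Proof.
move=> wv; apply/ler_addgt0Pr => e e0.
have k1 : 0 < k + 1 by rewrite ltr_wpDl.
have [|c [cw cv]] := wv (e / (k + 1)); first by rewrite divr_gt0.
have := nrmD (v - T c) (T c); rewrite subrK => /le_trans; apply.
have := nrmD w (iota c - w); rewrite subrKC => ciw.
apply: (@le_trans _ _ (e / (k + 1) + k * (nrm w + e / (k + 1)))).
  apply: lerD; first exact: ltW.
  apply: (le_trans (T_bounded c)); rewrite ler_wpM2l//.
  by apply: (le_trans ciw); rewrite lerD2l nrmB ltW.
rewrite mulrDr addrCA lerD2l -{1}(mul1r (e / _)) -mulrDl (addrC 1).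
by rewrite mulrC divfK// gt_eqF.
Qed.

Let closed_graph_total w : exists v, closed_graph w v.
Proof.
(* Small enough for the [T (c_ n)] to satisfy the hypothesis of [nrm_complete], and
   for [iota (c_ n)] to approach [w] at least as fast as they converge. *)
pose d := (4 * (k + 1))^-1.
have k1 : 0 < k + 1 by rewrite ltr_wpDl.
have d0 : 0 < d by rewrite invr_gt0 mulr_gt0.
have /choice[c_ cP] : forall n : nat, exists c, nrm (w - iota c) < d * 2^-1 ^+ n.
  by move=> n; apply: iota_dense; rewrite mulr_gt0// exprn_gt0.
have kd : k * d <= 4^-1.
  rewrite /d invfM mulrCA ler_piMr// ler_pdivrMr// mul1r lerDl//.
have d4 : d <= 4^-1 by rewrite /d invfM ler_piMr// invf_le1// lerDr.
have [n|v vP] := nrm_complete (u_ := T \o c_).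
  rewrite /= -raddfB; apply: (le_trans (T_bounded _)).
  have -> : iota (c_ n.+1 - c_ n) = (w - iota (c_ n)) - (w - iota (c_ n.+1)).
    by rewrite raddfB opprB [in RHS]addrC subrKA.
  have c1 := cP n; have c2 := cP n.+1.
  have e0 : 0 <= 2^-1 ^+ n :> R by rewrite exprn_ge0.
  have -> : 2^-1 ^+ n = 4^-1 * (2 * (2 * 2^-1 ^+ n)) :> R by field.
  apply: (@le_trans _ _ (k * (2 * (d * 2^-1 ^+ n)))).
    rewrite ler_wpM2l//; apply: (le_trans (nrmD _ _)); rewrite nrmN.
    rewrite mulr_natl mulr2n lerD//; first exact: ltW.
    apply: (le_trans (ltW c2)); rewrite ler_wpM2l ?(ltW d0)//.
    by rewrite exprS ler_piMl// invf_le1// ler1n.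
  nra.
exists v => e e0.
have [n hn] : exists n : nat, 2 * 2^-1 ^+ n < e.
  have h1 : `|2^-1| < 1 :> R by rewrite ger0_norm ?invr_ge0// invf_lt1// ltr1n.
  have /cvgrPdist_lt/(_ e e0)[n _ /(_ n (leqnn n))] := @cvg_geometric R 2 _ h1.
  rewrite sub0r normrN => h.
  by exists n; exact: le_lt_trans (ler_norm _) h.
exists (c_ n); split; last exact: le_lt_trans (vP n) hn.
apply: lt_trans hn; apply: (lt_le_trans (cP n)).
rewrite ler_wpM2r ?exprn_ge0//; apply: (le_trans d4).
lra.
Qed.

(** Completeness is assumed for rapidly converging sequences only: by density, the
    approximations of a vector can be chosen to converge as fast as desired. *)
Lemma bounded_linear_extension : exists B : {linear W -> W},
  (forall c, B (iota c) = T c) /\ forall w, nrm (B w) <= k * nrm w.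
Proof.
have uniq w v v' : closed_graph w v -> closed_graph w v' -> v = v'.
  move=> wv wv'; apply/eqP; rewrite -subr_eq0; apply/eqP/nrm_eq0.
  apply/eqP; rewrite eq_le nrm_ge0 andbT.
  have := closed_graph_bounded (closed_graph_linear (-1) wv' wv).
  by rewrite !scaleN1r addNr nrm0 mulr0 addrC.
have /choice[B BP] := closed_graph_total.
have Blin : linear B.
  move=> a u v; apply: uniq (BP _) _; exact: closed_graph_linear.
pose HB := GRing.isLinear.Build _ _ _ _ B Blin.
pose Blinear : {linear W -> W} := HB.pack B HB.
exists Blinear; split => [c|w]; last exact: closed_graph_bounded.
by apply: uniq (BP _) _ => e e0; exists c; rewrite !subrr nrm0.
Qed.
End bounded_linear_extension.

(** * L^p seminorms of real functions *)

Lemma cvgn_summable_increments (R : realType) (u v : nat -> R) :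
  (forall n, `|u n.+1 - u n| <= v n) -> cvgn (series v) -> cvgn u.
Proof.
move=> uv cv; have v0 n : 0 <= v n := le_trans (normr_ge0 _) (uv n).
have : cvgn (series (telescope u)).
  apply: normed_cvg; apply: (series_le_cvg _ v0 uv cv).
  by move=> n; exact: normr_ge0.
rewrite telescopeK => /(is_cvgD (is_cvg_cst (u 0%N))) uc.
suff -> : u = (fun n => u 0%N + (u n - u 0%N)) by exact: uc.
by apply/funext => n; rewrite subrKC.
Qed.

Section Lnorm_facts.
Context d (T : measurableType d) (R : realType).
Variables (mu : {measure set T -> \bar R}) (p : R) (p1 : 1 <= p).
Local Notation N f := ('N[mu]_p%:E [EFin \o f])%E.
Implicit Types f g : T -> R.

Let p0 : 0 < p. Proof. exact: lt_le_trans p1. Qed.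

Lemma measurable_normr_powR f : measurable_fun setT f ->
  measurable_fun setT (fun z => (`|f z| `^ p)%:E).
Proof.
move=> mf; apply/measurable_EFinP.
apply: (@measurableT_comp _ _ _ _ _ _ (fun x : R => x `^ p)) => //.
exact: measurableT_comp.
Qed.

Lemma cvg_normr_powR (u_ : nat -> R) (l : R) :
  u_ n @[n --> \oo] --> l -> `|u_ n| `^ p @[n --> \oo] --> `|l| `^ p.
Proof.
move=> ul; have [l0|l0] := eqVneq l 0.
  (* The power map need not be differentiable at 0. *)
  rewrite l0 normr0 powR0 ?gt_eqF//; apply/cvgrPdist_lt => e e0.
  have ep : 0 < e `^ p^-1 by rewrite powR_gt0.
  move/cvgrPdist_lt : ul => /(_ _ ep); apply: filterS => n.
  rewrite l0 !sub0r !normrN [X in _ -> X < _]ger0_norm ?powR_ge0// => une.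
  have := gt0_ltr_powR p0 _ _ une; rewrite -powRrM mulVf ?gt_eqF// powRr1 ?ltW//.
  by apply; rewrite nnegrE// powR_ge0.
apply: (@continuous_cvg _ _ _ (\oo) _ (fun n => `|u_ n|) (fun x : R => x `^ p)).
  apply: differentiable_continuous; apply/derivable1_diffP.
  by apply: derivable_powR; rewrite in_itv/= normr_gt0 l0.
exact: cvg_norm.
Qed.

Lemma ae_le_Lnorm f g : measurable_fun setT f -> measurable_fun setT g ->
  {ae mu, forall z, `|f z| <= `|g z|} -> (N f <= N g)%E.
Proof.
move=> mf mg fg; rewrite unlock /=; apply: gt0_ler_poweR.
- by rewrite invr_ge0 ltW.
- by rewrite in_itv/= leey integral_ge0.
- by rewrite in_itv/= leey integral_ge0.
apply: ae_ge0_le_integral => //; try exact: measurable_normr_powR.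
by apply: filterS fg => z fgz _; rewrite lee_fin ge0_ler_powR// ?nnegrE// ltW.
Qed.

Lemma le_Lnorm f g : measurable_fun setT f -> measurable_fun setT g ->
  (forall z, `|f z| <= `|g z|) -> (N f <= N g)%E.
Proof. by move=> mf mg fg; apply: ae_le_Lnorm => //; exact: aeW. Qed.

Lemma ae_eq_Lnorm f g : measurable_fun setT f -> measurable_fun setT g ->
  {ae mu, forall z, f z = g z} -> N f = N g.
Proof.
move=> mf mg fg; apply/eqP; rewrite eq_le; apply/andP; split.
  by apply: ae_le_Lnorm => //; apply: filterS fg => z ->.
by apply: ae_le_Lnorm => //; apply: filterS fg => z ->.
Qed.

Lemma LnormMl (k : R) f : measurable_fun setT f ->
  ('N[mu]_p%:E [EFin \o (fun z => k * f z)%R] = `|k|%:E * N f)%E.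
Proof.
move=> mf; rewrite unlock /=.
under eq_integral do rewrite normrM powRM// EFinM.
rewrite ge0_integralZl_EFin//; last exact: measurable_normr_powR.
rewrite poweRM ?integral_ge0 ?lee_fin ?powR_ge0//.
by rewrite poweR_EFin -powRrM mulfV ?gt_eqF// powRr1.
Qed.

(** Passing from norms to integrals, to which convergence theorems apply. *)
Lemma Lnorm_leP f (C : R) : 0 <= C ->
  (N f <= C%:E)%E <-> (\int[mu]_z (`|f z| `^ p)%:E <= (C `^ p)%:E)%E.
Proof.
move=> C0; have pn0 : p != 0 by rewrite gt_eqF.
have -> : (\int[mu]_z (`|f z| `^ p)%:E = N f `^ p)%E by rewrite poweR_Lnorm.
rewrite -poweR_EFin; split => h.
  apply: gt0_ler_poweR => //; first exact: ltW.
  - by rewrite in_itv/= Lnorm_ge0 leey.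
  - by rewrite in_itv/= leey lee_fin C0.
rewrite -(@poweRe1 _ (N f)) ?Lnorm_ge0// -(@poweRe1 _ C%:E) ?lee_fin//.
rewrite -(mulfV pn0) !poweRrM; apply: gt0_ler_poweR => //.
- by rewrite invr_ge0 ltW.
- by rewrite in_itv; apply/andP; split; [exact: poweR_ge0|exact: leey].
- by rewrite in_itv; apply/andP; split; [exact: poweR_ge0|exact: leey].
Qed.

Lemma measurable_limn_einf (u_ : nat -> T -> \bar R) :
  (forall n, measurable_fun setT (u_ n)) ->
  measurable_fun setT (fun z => limn_einf (u_ ^~ z)).
Proof.
move=> mu_; apply: measurableT_comp => //; apply: measurable_fun_limn_esup => n.
exact: measurableT_comp.
Qed.

Lemma fatou_Lnorm (f_ : nat -> T -> R) (C : R) : 0 <= C ->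
  (forall n, measurable_fun setT (f_ n)) -> (forall n, (N (f_ n) <= C%:E)%E) ->
  (\int[mu]_z limn_einf (fun n => (`|f_ n z| `^ p)%:E) <= (C `^ p)%:E)%E.
Proof.
move=> C0 mf fC.
have := @fatou _ _ _ mu setT measurableT (fun n z => (`|f_ n z| `^ p)%:E).
move=> /(_ (fun n => measurable_normr_powR (mf n))) /(_ _)/le_trans; apply.
  by move=> n z _; rewrite lee_fin powR_ge0.
rewrite limn_einf_lim; apply: lime_le; first exact: is_cvg_einfs.
apply: nearW => n; apply: (@le_trans _ _ (\int[mu]_z (`|f_ n z| `^ p)%:E)%E).
  by apply: ereal_inf_lbound; exists n => /=.
exact/Lnorm_leP.
Qed.

(** By Fatou's lemma the lower limit of the [`|f_ n z| `^ p] is integrable, hence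
    finite almost everywhere; for an increasing sequence it bounds every term. *)
Lemma ae_bounded_Lnorm (f_ : nat -> T -> R) (C : R) : 0 <= C ->
  (forall n, measurable_fun setT (f_ n)) ->
  (forall z, nondecreasing_seq (fun n => `|f_ n z|)) ->
  (forall n, (N (f_ n) <= C%:E)%E) ->
  {ae mu, forall z, exists B : R, forall n, `|f_ n z| <= B}.
Proof.
move=> C0 mf nd fC; pose u n z := (`|f_ n z| `^ p)%:E.
have iu : mu.-integrable setT (fun z => limn_einf (u ^~ z)).
  apply/integrableP; split.
    by apply: measurable_limn_einf => n; exact: measurable_normr_powR.
  under eq_integral => z _.
    rewrite gee0_abs; last first.
      rewrite limn_einf_lim; apply: lime_ge; first exact: is_cvg_einfs.
      apply: nearW => n; apply: le_ereal_inf_tmp => _ [m _ <-].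
      by rewrite lee_fin powR_ge0.
    over.
  exact: le_lt_trans (fatou_Lnorm C0 mf fC) (ltry _).
have := integrable_ae measurableT iu.
apply: filterS => z /(_ Logic.I) ufin.
exists (fine (limn_einf (u ^~ z)) `^ p^-1) => n.
have un : `|f_ n z| `^ p <= fine (limn_einf (u ^~ z)).
  rewrite -lee_fin fineK// limn_einf_lim; apply: lime_ge.
    exact: is_cvg_einfs.
  exists n => // k /= nk; apply: le_ereal_inf_tmp => _ [m /= km <-].
  by rewrite lee_fin ge0_ler_powR ?(ltW p0) ?nnegrE// nd// (leq_trans nk).
rewrite -[leLHS](powRr1 (normr_ge0 _)) -(mulfV (lt0r_neq0 p0)) powRrM.
rewrite ge0_ler_powR ?nnegrE ?powR_ge0 ?invr_ge0 ?(ltW p0)//.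
by rewrite (le_trans _ un) ?powR_ge0.
Qed.

(** Fatou's lemma in L^p form: balls are closed under convergence almost
    everywhere. *)
Lemma ae_cvg_Lnorm_le (f_ : nat -> T -> R) f (C : R) : 0 <= C ->
  (forall n, measurable_fun setT (f_ n)) -> measurable_fun setT f ->
  (forall n, (N (f_ n) <= C%:E)%E) ->
  {ae mu, forall z, f_ n z @[n --> \oo] --> f z} -> (N f <= C%:E)%E.
Proof.
move=> C0 mf_ mf fC cf; apply/Lnorm_leP => //.
apply: le_trans (fatou_Lnorm C0 mf_ fC).
apply: ae_ge0_le_integral => //.
- exact: measurable_normr_powR.
- move=> z _; rewrite limn_einf_lim; apply: lime_ge; first exact: is_cvg_einfs.
  apply: nearW => n; apply: le_ereal_inf_tmp => _ [m _ <-].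
  by rewrite lee_fin powR_ge0.
- by apply: measurable_limn_einf => n; exact: measurable_normr_powR.
apply: filterS cf => z fz _.
have h : (`|f_ n z| `^ p)%:E @[n --> \oo] --> (`|f z| `^ p)%:E.
  by apply: cvg_EFin; [exact: nearW|exact: cvg_normr_powR].
by rewrite (cvg_limn_einf_sup h).1.
Qed.
End Lnorm_facts.

Section dominated_Lnorm.
Context d (T : measurableType d) (R : realType).
Variables (mu : {measure set T -> \bar R}) (p : R) (p1 : 1 <= p).
Local Notation N f := ('N[mu]_p%:E [EFin \o f])%E.

Lemma dominated_Lnorm (f_ : nat -> T -> R) (g : T -> R) :
  (forall n, measurable_fun setT (f_ n)) -> measurable_fun setT g ->
  (N g < +oo)%E -> (forall n z, `|f_ n z| <= `|g z|) ->
  (forall z, f_ n z @[n --> \oo] --> 0) ->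
  forall e, 0 < e -> exists n, (N (f_ n) <= e%:E)%E.
Proof.
move=> mf mg Ng fg f0 e e0; have p0 : 0 < p by exact: lt_le_trans p1.
have Ng0 : N g = (fine (N g))%:E by rewrite fineK// ge0_fin_numE// Lnorm_ge0.
have [] := @dominated_convergence _ _ _ mu setT measurableT
    (fun n z => (`|f_ n z| `^ p)%:E) (cst 0%E) (fun z => (`|g z| `^ p)%:E).
- by move=> n; exact: measurable_normr_powR.
- exact: measurable_cst.
- apply: aeW => z _; have := cvg_normr_powR p1 (f0 z).
  rewrite normr0 powR0 ?gt_eqF// => h.
  by apply: cvg_EFin => //; exact: nearW.
- apply/integrableP; split; first exact: measurable_normr_powR.
  under eq_integral do rewrite gee0_abs ?lee_fin ?powR_ge0//.
  have : (N g <= (fine (N g))%:E)%E by rewrite -Ng0.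
  move/(Lnorm_leP _ p1 _ (fine_ge0 (Lnorm_ge0 _ _ _))) => /le_lt_trans; apply.
  exact: ltry.
- apply: aeW => z n _; rewrite gee0_abs ?lee_fin ?powR_ge0//.
  by rewrite ge0_ler_powR ?nnegrE// ltW.
move=> _ _; rewrite integral0 => /fine_cvgP[fin cv].
have ep : 0 < e `^ p by rewrite powR_gt0.
have [n1 _ h1] := fin; have /cvgrPdist_lt /(_ _ ep)[n2 _ h2] := cv.
exists (maxn n1 n2); apply/(Lnorm_leP _ p1) => //; first exact: ltW.
have := h2 _ (leq_maxr n1 n2); rewrite /= sub0r normrN.
move=> /ltW/(le_trans (ler_norm _)); rewrite -lee_fin fineK//.
exact: h1 (leq_maxl n1 n2).
Qed.

Lemma finite_measure_decreasing (B_ : nat -> set T) : (mu setT < +oo)%E ->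
  (forall n, measurable (B_ n)) -> nonincreasing_seq B_ ->
  \bigcap_n B_ n = set0 ->
  forall e, 0 < e -> exists n, (mu (B_ n) < e%:E)%E.
Proof.
move=> fmu mB ndB B0 e e0.
have fB n : (mu (B_ n) < +oo)%E.
  by apply: le_lt_trans fmu; apply: le_measure; rewrite ?inE//; exact: measurableT.
have := nonincreasing_cvg_mu (fB 0%N) mB.
rewrite B0 measure0 => /(_ measurable0 ndB) /fine_cvgP[_].
move=> /cvgrPdist_lt /(_ _ e0)[n _ /(_ n (leqnn n))]; rewrite /= sub0r normrN.
move=> /(le_lt_trans (ler_norm _)) h; exists n.
by rewrite -lte_fin fineK// in h; rewrite ge0_fin_numE// measure_ge0.
Qed.
End dominated_Lnorm.

(** * Norm and completeness of complex L^p spaces *)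

Section Lp_norm_theory.
Context d (T : measurableType d) (R : realType).
Variables (mu : {measure set T -> \bar R}) (p : R) (p1 : 1 <= p).
Local Notation NC f := ('N[mu]_p%:E [EFin \o (fun z => normc (f%R z))])%E.
Local Notation Lp := (Lp mu p1).
Implicit Types (f g : Lp_fun mu p1) (u v : Lp).

Lemma Lp_funP f : [/\ measurable_fun setT (fun z => Re (f z)),
  measurable_fun setT (fun z => Im (f z)) & (NC f < +oo)%E].
Proof. by case: f => f /=; rewrite inE => -[]. Qed.

Lemma Lp_fun_normc f : measurable_fun setT (fun z => normc (f z)).
Proof. by have [mR mI _] := Lp_funP f; exact: measurable_normc. Qed.

(** The norm is defined through a chosen representative; any other one agrees with
    it almost everywhere. *)
Lemma Lp_norm_class f : Lp_norm (Lp_class f) = NC f.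
Proof.
have /Lp_classP fE : Lp_class f = Lp_class (repr (Lp_class f)).
  by rewrite Lp_class_repr.
apply: ae_eq_Lnorm => //; [exact: Lp_fun_normc|exact: Lp_fun_normc|].
by apply: filterS fE => z ->.
Qed.

(** The norm is finite on L^p, so that working with its real value loses nothing. *)
Definition Lp_nrm u : R := fine (Lp_norm u).

Lemma Lp_nrmE u : (Lp_nrm u)%:E = Lp_norm u.
Proof.
rewrite fineK// ge0_fin_numE; last exact: Lnorm_ge0.
by rewrite -[u]Lp_class_repr Lp_norm_class; have [] := Lp_funP (repr u).
Qed.

Lemma Lp_nrmD u v : Lp_nrm (u + v) <= Lp_nrm u + Lp_nrm v.
Proof.
rewrite -lee_fin EFinD !Lp_nrmE -[u]Lp_class_repr -[v]Lp_class_repr.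
set f := repr u; set g := repr v; rewrite -Lp_classD !Lp_norm_class.
have mf := Lp_fun_normc f; have mg := Lp_fun_normc g.
apply: le_trans (minkowski_EFin mu mf mg p1).
apply: le_Lnorm => //; [exact: Lp_fun_normc|exact: measurable_funD|move=> z].
rewrite !ger0_norm ?addr_ge0 ?normc_ge0//.
change (normc (f z + g z) <= normc (f z) + normc (g z)); exact: (@le_normcD R).
Qed.

Lemma Lp_nrmZ a u : Lp_nrm (a *: u) = normc a * Lp_nrm u.
Proof.
apply: EFin_inj; rewrite EFinM !Lp_nrmE -[u]Lp_class_repr.
rewrite -[a *: _]/(Lp_scale a _) -Lp_classZ !Lp_norm_class.
rewrite -[in RHS](ger0_norm (normc_ge0 a)) -LnormMl//; last exact: Lp_fun_normc.
by apply: eq_Lnorm => z; rewrite /= -normcM.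
Qed.

Lemma Lp_nrm_eq0 u : Lp_nrm u = 0 -> u = 0.
Proof.
move=> u0; have := Lp_nrmE u; rewrite u0 => /esym.
rewrite -[u]Lp_class_repr Lp_norm_class.
move=> /Lnorm_eq0_eq0 h; have -> : 0 = Lp_class (0 : Lp_fun mu p1).
  by rewrite /Lp_class raddf0.
apply/Lp_classP; move: h => /(_ _ _); rewrite lte_fin (lt_le_trans _ p1)//.
have := Lp_fun_normc (repr u); move=> /measurable_EFinP mu' /(_ mu' isT).
by apply: filterS => z /(_ Logic.I)[] /eq0_normc.
Qed.

Lemma Lp_classB f g : Lp_class (f - g) = Lp_class f - Lp_class g.
Proof. exact: raddfB. Qed.

Lemma Lp_nrm_telescope (u_ : nat -> Lp) n m :
  (forall k, Lp_nrm (u_ k.+1 - u_ k) <= 2^-1 ^+ k) ->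
  Lp_nrm (u_ (n + m)%N - u_ n) <= 2 * 2^-1 ^+ n.
Proof.
move=> u_le; suff : Lp_nrm (u_ (n + m)%N - u_ n) <=
    2 * 2^-1 ^+ n - 2 * 2^-1 ^+ (n + m).
  by move=> /le_trans; apply; rewrite gerBl mulr_ge0// exprn_ge0.
elim: m => [|m IH].
  rewrite addn0 !subrr; have := Lp_nrmZ 0 0.
  by rewrite scale0r normc0 mul0r => ->.
rewrite addnS -(subrKA (u_ (n + m)%N)); apply: (le_trans (Lp_nrmD _ _)).
apply: (le_trans (lerD (u_le _) IH)); rewrite exprS.
lra.
Qed.

(** The Riesz-Fischer theorem, for rapidly converging sequences: the partial sums
    of the [normc (f_ k.+1 - f_ k)] are bounded in L^p, hence bounded almost
    everywhere, so that [f_ n] converges pointwise almost everywhere. Fatou's lemma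
    then bounds the distance from the pointwise limit to each term. *)
Lemma Lp_nrm_complete (u_ : nat -> Lp) :
  (forall n, Lp_nrm (u_ n.+1 - u_ n) <= 2^-1 ^+ n) ->
  exists u, forall n, Lp_nrm (u - u_ n) <= 2 * 2^-1 ^+ n.
Proof.
move=> u_le; pose f_ n := repr (u_ n).
have f_u m n : Lp_norm (u_ m - u_ n) = NC (f_ m - f_ n).
  by rewrite -Lp_norm_class Lp_classB !Lp_class_repr.
pose D k z := normc ((f_ k.+1 - f_ k) z).
have mD k : measurable_fun setT (D k) by exact: Lp_fun_normc.
pose s n z := series (D^~ z) n.
have ms n : measurable_fun setT (s n).
  by rewrite /s; under eq_fun do rewrite seriesEnat/=; exact: measurable_sum.
have Ns n : ('N[mu]_p%:E [EFin \o s n] <= 2%:E)%E.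
  suff : ('N[mu]_p%:E [EFin \o s n] <= (2 - 2 * 2^-1 ^+ n)%:E)%E.
    by move/le_trans; apply; rewrite lee_fin gerBl mulr_ge0// exprn_ge0.
  elim: n => [|n IH].
    rewrite (_ : EFin \o s 0%N = cst 0%E); last first.
      by apply/funext => z /=; rewrite /s seriesEnat/= big_nil.
    rewrite Lnorm0 ?expr0 ?mulr1 ?subrr//.
    by rewrite eqe gt_eqF// (lt_le_trans _ p1).
  rewrite (_ : s n.+1 = (s n \+ D n)%R); last first.
    by apply/funext => z; rewrite /s /= seriesSr.
  apply: (le_trans (minkowski_EFin mu (ms n) (mD n) p1)).
  have := u_le n; rewrite -lee_fin Lp_nrmE f_u => Dn.
  by apply: (le_trans (leeD IH Dn)); rewrite -EFinD lee_fin exprS; lra.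
have D0 k z : 0 <= D k z by exact: normc_ge0.
have nds z : nondecreasing_seq (s ^~ z).
  by apply/nondecreasing_seqP => n; rewrite /s seriesSr lerDl.
have s0 n z : 0 <= s n z by rewrite /s seriesEnat/= sumr_ge0.
have sbd : {ae mu, forall z, exists B : R, forall n, `|s n z| <= B}.
  apply: (@ae_bounded_Lnorm _ _ _ mu p p1 s 2) => // z m n mn.
  by rewrite !ger0_norm//; exact: nds.
pose r n z := Re (f_ n z); pose i n z := Im (f_ n z).
have cvg_part (h : nat -> T -> R) z :
    (forall n, `|h n.+1 z - h n z| <= D n z) ->
    (exists B : R, forall n, `|s n z| <= B) -> cvgn (h ^~ z).
  move=> hD [B sB]; apply: (cvgn_summable_increments hD).
  apply: nondecreasing_is_cvgn; first exact: nds.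
  by exists B => _ [n _ <-]; exact: le_trans (ler_norm _) (sB n).
(* An upper limit is measurable without any convergence assumption. *)
pose L (h : nat -> T -> R) z : R := fine (limn_esup (fun n => (h n z)%:E)).
have mL h : (forall n, measurable_fun setT (h n)) -> measurable_fun setT (L h).
  move=> mh; apply: measurableT_comp; first exact: fine_measurable.
  by apply: measurable_fun_limn_esup => n; exact/measurable_EFinP.
have cL (h : nat -> T -> R) z : cvgn (fun n => h n z) -> h n z @[n --> \oo] --> L h z.
  move=> ch; have : (h n z)%:E @[n --> \oo] --> (limn (h ^~ z))%:E.
    by apply: cvg_EFin => //; exact: nearW.
  by rewrite /L => /cvg_limn_einf_sup[_ ->].
pose g z : R[i] := (L r z +i* L i z)%C.
have fP n := Lp_funP (f_ n).
have mr n : measurable_fun setT (r n) by have [] := fP n.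
have mi n : measurable_fun setT (i n) by have [] := fP n.
have g_ae : {ae mu, forall z, r n z @[n --> \oo] --> Re (g z) /\
                              i n z @[n --> \oo] --> Im (g z)}.
  apply: filterS sbd => z sz; split; apply: cL; apply: cvg_part => // n.
  - exact: normr_Re_le.
  - exact: normr_Im_le.
have mg n : measurable_fun setT (fun z => Re (g z - f_ n z)) /\
            measurable_fun setT (fun z => Im (g z - f_ n z)).
  split.
    rewrite (_ : (fun z => _) = L r \- r n)%R; last first.
      by apply/funext => z; rewrite /g /r /=; case: (f_ n z).
    by apply: measurable_funB => //; exact: mL.
  rewrite (_ : (fun z => _) = L i \- i n)%R; last first.
    by apply/funext => z; rewrite /g /i /=; case: (f_ n z).
  by apply: measurable_funB => //; exact: mL.
have gP n : (NC (fun z => g z - f_ n z) <= (2 * 2^-1 ^+ n)%:E)%E.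
  pose F m z := normc ((f_ (n + m)%N - f_ n) z).
  apply: (@ae_cvg_Lnorm_le _ _ _ mu p p1 F) => //.
  - by move=> m; exact: Lp_fun_normc.
  - by have [] := mg n; exact: measurable_normc.
  - move=> m; have := Lp_nrm_telescope n m u_le.
    by rewrite -lee_fin Lp_nrmE f_u.
  apply: filterS g_ae => z [rz iz].
  have c : (r (n + m)%N z - r n z) ^+ 2 + (i (n + m)%N z - i n z) ^+ 2
      @[m --> \oo] --> (Re (g z) - r n z) ^+ 2 + (Im (g z) - i n z) ^+ 2.
    have shift (h : nat -> R) (l : R) : h m @[m --> \oo] --> l ->
        h (n + m)%N @[m --> \oo] --> l.
      by rewrite -(cvg_shiftn n); under eq_fun do rewrite addnC.
    rewrite !expr2; under eq_fun do rewrite !expr2.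
    apply: cvgD; apply: cvgM; apply: cvgB;
      first [exact: (shift _ _ rz)|exact: (shift _ _ iz)|exact: cvg_cst].
  rewrite normcB_E; suff -> : F ^~ z = (fun m =>
      Num.sqrt ((r (n + m)%N z - r n z) ^+ 2 + (i (n + m)%N z - i n z) ^+ 2)).
    exact: (@continuous_cvg _ _ _ \oo _ _ Num.sqrt _ (@sqrt_continuous R _) c).
  by apply/funext => m; rewrite /F -normcB_E.
(* [g] is in L^p because [g - f_ 0] and [f_ 0] are. *)
have h0P : (fun z => g z - f_ 0%N z : R[i]^o) \in is_Lp mu p1.
  rewrite inE; have [mgR mgI] := mg 0%N; split => //.
  exact: le_lt_trans (gP 0%N) (ltry _).
pose G := MkLp_fun h0P + f_ 0%N.
have GE z : G z = g z by change (g z - f_ 0%N z + f_ 0%N z = g z); rewrite subrK.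
exists (Lp_class G) => n; rewrite -lee_fin Lp_nrmE -[u_ n]Lp_class_repr -Lp_classB.
rewrite Lp_norm_class; apply: le_trans (gP n).
suff -> : NC (G - repr (u_ n)) = NC (fun z => g z - f_ n z) by [].
by apply: eq_Lnorm => z; rewrite /= -GE.
Qed.
End Lp_norm_theory.

(** * Clamping to an interval *)

Section clamp.
Variable R : realType.
Implicit Types a b s : R.

Definition clamp a b s := Num.max a (Num.min b s).

Lemma clamp_continuous a b : continuous (clamp a b).
Proof.
(* Maximum and minimum are written with absolute values. *)
have -> : clamp a b = fun s =>
    (a + (b + s - `|b - s|) / 2 + `|a - (b + s - `|b - s|) / 2|) / 2.
  by apply/funext => s; rewrite /clamp maxr_absE minr_absE.
move=> s; have cs : s' @[s' --> s] --> s by exact: cvg_id.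
have cmin : (b + s' - `|b - s'|) / 2 @[s' --> s] --> (b + s - `|b - s|) / 2.
  apply: cvgM; last exact: cvg_cst.
  apply: cvgB; first by apply: cvgD => //; exact: cvg_cst.
  by apply: cvg_norm; apply: cvgB => //; exact: cvg_cst.
apply: cvgM; last exact: cvg_cst.
apply: cvgD; first by apply: cvgD => //; exact: cvg_cst.
by apply: cvg_norm; apply: cvgB => //; exact: cvg_cst.
Qed.

Lemma clamp_in a b s : a <= b -> a <= clamp a b s <= b.
Proof. by move=> ab; rewrite /clamp le_max lexx ge_max ab ge_min lexx. Qed.

Lemma clamp_id a b s : a <= s <= b -> clamp a b s = s.
Proof. by move=> /andP[as_ sb]; rewrite /clamp min_r// max_r. Qed.

Lemma clamp_le a b s : a <= b -> s <= a -> clamp a b s = a.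
Proof. by move=> ab sa; rewrite /clamp max_l// ge_min sa orbT. Qed.

Lemma clamp_ge a b s : a <= b -> b <= s -> clamp a b s = b.
Proof. by move=> ab bs; rewrite /clamp min_l// max_r. Qed.
End clamp.

(** * Density of the continuous functions in L^p of a rectangle *)

Section Cont_restr.
Variables (R : realType) (K : set (R * R)).

Lemma Cont_restr_proof (h : R * R -> R^o) : {within K, continuous h} ->
  let hK z : R^o := if z \in K then h z else 0 in
  {within K, continuous hK} /\ forall z, ~ K z -> hK z = 0.
Proof.
move=> ch hK; split; last by move=> z Kz; rewrite /hK memNset.
by apply: subspace_eq_continuous ch => z zK; rewrite /from_subspace /hK zK.
Qed.

(** Elements of [Cont K R] vanish off [K], so a function that is continuous within
    [K] has to be cut off to become one. *)
Definition Cont_restr (h : R * R -> R^o) (ch : {within K, continuous h}) :=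
  Cont_of (Cont_restr_proof ch).1 (Cont_restr_proof ch).2.

Lemma Cont_restrE h (ch : {within K, continuous h}) z :
  Cont_restr ch z = if z \in K then h z else 0.
Proof. by []. Qed.

Lemma Cont_restr_in h (ch : {within K, continuous h}) z : K z ->
  Cont_restr ch z = h z.
Proof. by move=> Kz; rewrite Cont_restrE mem_set. Qed.

Lemma Cont0E z : (0 : Cont K R) z = 0 :> R.
Proof. by []. Qed.

Lemma Cont_out (f : Cont K R) z : ~ K z -> f z = 0.
Proof. exact: (ContP f).2. Qed.
End Cont_restr.

Section almost_continuous.
Variables (R : realType) (a b c d : R).
Local Notation K := (rect a b c d).
Local Notation mu := (rect_measure a b c d).
Local Notation T := (measurableTypeR R * measurableTypeR R)%type.
Implicit Types A B : set T.

(** Lusin's property for indicators. Asking for a small exceptional set instead of a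
    small L^p distance makes the closure properties set-theoretic; the bounds on [g]
    make the L^p distance small in the end. *)
Definition almost_continuous A := measurable A /\ forall e, 0 < e ->
  exists (g : Cont K R) B, [/\ measurable B, (mu B < e%:E)%E,
    forall z, 0 <= g z <= 1 & forall z, K z -> ~ B z -> g z = \1_A z].

Lemma almost_continuous0 : almost_continuous set0.
Proof.
split=> // e e0; exists 0, set0; split => //.
- by rewrite measure0 lte_fin.
- by move=> z; rewrite Cont0E lexx ler01.
- by move=> z _ _; rewrite indic0.
Qed.

Lemma almost_continuousC A : almost_continuous A -> almost_continuous (~` A).
Proof.
move=> [mA hA]; split; first exact: measurableC.
move=> e /hA[g [B [mB Be g01 gE]]].
have c1 : {within K, continuous (fun z => 1 - g z : R^o)}.
  by move=> z; apply: cvgB; [exact: cvg_cst|exact: (ContP g).1].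
exists (Cont_restr c1), B; split => //.
- move=> z; rewrite Cont_restrE; case: ifP => _; last by rewrite lexx ler01.
  by have /andP[g0 g1] := g01 z; rewrite subr_ge0 g1 lerBlDr lerDl.
- move=> z Kz Bz; rewrite Cont_restr_in// gE// !indicE in_setC.
  by case: (z \in A); rewrite ?subrr ?subr0.
Qed.

Lemma measureU_lt A B e : measurable A -> measurable B ->
  (mu A < (e / 2)%:E)%E -> (mu B < (e / 2)%:E)%E -> (mu (A `|` B) < e%:E)%E.
Proof.
move=> mA mB Ae Be; rewrite (splitr e) EFinD.
apply: (@le_lt_trans _ _ (mu A + mu B)%E); first exact: measureU2.
by apply: lteD.
Qed.

Lemma probsum_in01 (u v : R) : 0 <= u <= 1 -> 0 <= v <= 1 -> 0 <= u + v - u * v <= 1.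
Proof. by move=> /andP[u0 u1] /andP[v0 v1]; apply/andP; split; nra. Qed.

Lemma probsum_bool (u v : bool) : u%:R + v%:R - u%:R * v%:R = (u || v)%:R :> R.
Proof. by case: u; case: v => /=; ring. Qed.

Lemma almost_continuousU A B : almost_continuous A -> almost_continuous B ->
  almost_continuous (A `|` B).
Proof.
move=> [mA hA] [mB hB]; split; first exact: measurableU.
move=> e e0; have e2 : 0 < e / 2 by rewrite divr_gt0.
have [g [X [mX Xe g01 gE]]] := hA _ e2; have [h [Y [mY Ye h01 hE]]] := hB _ e2.
(* [u + v - u * v] maps [0, 1] x [0, 1] into [0, 1] and extends disjunction. *)
have cu : {within K, continuous (fun z => g z + h z - (g z : R) * h z : R^o)}.
  move=> z; have cg := (ContP g).1 z; have ch := (ContP h).1 z.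
  by apply: cvgB; [exact: cvgD|exact: cvgM].
exists (Cont_restr cu), (X `|` Y); split.
- exact: measurableU.
- exact: measureU_lt.
- move=> z; rewrite Cont_restrE; case: ifP => _; last by rewrite lexx ler01.
  exact: probsum_in01.
- move=> z Kz /not_orP[Xz Yz]; rewrite Cont_restr_in// gE// hE// !indicE in_setU.
  exact: probsum_bool.
Qed.

(** The measure being finite, the finite unions exhaust a countable union up to a
    set of small measure. *)
Lemma almost_continuous_bigcup (A_ : nat -> set T) :
  (forall n, almost_continuous (A_ n)) -> almost_continuous (\bigcup_n A_ n).
Proof.
move=> hA; have mA n : measurable (A_ n) by exact: (hA n).1.
split; first exact: bigcup_measurable.
move=> e e0; have e2 : 0 < e / 2 by rewrite divr_gt0.
pose U n := \big[setU/set0]_(k < n) A_ k.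
have aU n : almost_continuous (U n).
  rewrite /U; elim: n => [|n IH]; first by rewrite big_ord0; exact: almost_continuous0.
  by rewrite big_ord_recr; exact: almost_continuousU.
have mU n : measurable (U n) by exact: (aU n).1.
have mUA : measurable (\bigcup_n A_ n) by exact: bigcup_measurable.
have [n Dn] : exists n, (mu (\bigcup_n A_ n `\` U n) < (e / 2)%:E)%E.
  apply: finite_measure_decreasing => //.
  - exact: rect_measure_lty.
  - by move=> n; exact: measurableD.
  - move=> m n mn; apply/subsetPset; apply: setDS.
    by rewrite /U -!(bigcup_mkord _ A_); apply: bigcup_subset => k /= /leq_trans; apply.
  - rewrite -subset0 => z zD; have [[k _ Akz] _] := zD 0%N I.
    have [_] := zD k.+1 I; apply; rewrite /U -bigcup_mkord.
    by exists k => //=.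
have [g [B [mB Be g01 gE]]] := (aU n).2 _ e2.
exists g, (B `|` (\bigcup_n A_ n `\` U n)); split => //.
- by apply: measurableU => //; exact: measurableD.
- by apply: measureU_lt => //; exact: measurableD.
move=> z Kz /not_orP[Bz Dz]; rewrite gE// !indicE; congr (_%:R).
congr nat_of_bool; apply/idP/idP; rewrite !inE.
  by rewrite /U -bigcup_mkord => -[k _ Akz]; exists k.
by move=> Az; apply: contrapT => Uz; exact: Dz.
Qed.

Lemma almost_continuous_sigma : sigma_algebra setT almost_continuous.
Proof.
split; [exact: almost_continuous0| |exact: almost_continuous_bigcup].
by move=> A; rewrite setTD; exact: almost_continuousC.
Qed.

(** The ramp from 0 to 1 on an interval of length [n.+1%:R^-1] is the
    indicator of a ray away from that interval. *)
Lemma almost_continuous_ray (pr : T -> measurableTypeR R) (s : R) :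
  continuous (pr : R * R -> R) -> measurable_fun setT pr ->
  almost_continuous (pr @^-1` `]s, +oo[).
Proof.
move=> cpr mpr; split.
  by rewrite -[_ @^-1` _]setTI; apply: mpr => //; exact: measurable_itv.
move=> e e0; pose B n := pr @^-1` `]s, s + n.+1%:R^-1[.
have mB n : measurable (B n).
  by rewrite -[B n]setTI; apply: mpr => //; exact: measurable_itv.
have [n Bn] : exists n, (mu (B n) < e%:E)%E.
  apply: finite_measure_decreasing => //; first exact: rect_measure_lty.
  - move=> m n mn; apply/subsetPset => z; rewrite /B /= !in_itv/= => /andP[-> zn].
    by rewrite (lt_le_trans zn)// lerD2l lef_pV2 ?posrE// ler_nat.
  - rewrite -subset0 => z zB; have := zB 0%N I.
    rewrite /B /= in_itv/= => /andP[sz _]; have := sz; rewrite -subr_gt0 => sz0.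
    have [n _ /(_ n (leqnn n)) /= nz] := near_infty_natSinv_lt (PosNum sz0).
    have := zB n I; rewrite /B /= in_itv/= => /andP[_].
    by rewrite -ltrBlDl => /lt_trans/(_ nz); rewrite ltxx.
pose h z : R := clamp 0 1 (n.+1%:R * (pr z - s)).
have ch : {within K, continuous (h : R * R -> R^o)}.
  apply: continuous_subspaceT => z.
  apply: (@continuous_comp _ _ _ (fun z => n.+1%:R * (pr z - s)) (clamp 0 1)).
    apply: cvgM; first exact: cvg_cst.
    by apply: cvgB; [exact: cpr|exact: cvg_cst].
  exact: clamp_continuous.
exists (Cont_restr ch), (B n); split => //.
- move=> z; rewrite Cont_restrE; case: ifP => _; last by rewrite lexx ler01.
  by apply: clamp_in.
- move=> z Kz; rewrite Cont_restr_in// /B /h /= in_itv/= => /negP.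
  rewrite negb_and -!leNgt indicE.
  move=> /orP[zs|zs].
    rewrite memNset ?clamp_le//=; last by rewrite in_itv/= ltNge zs.
    by rewrite pmulr_rle0// subr_le0.
  rewrite mem_set ?clamp_ge//=.
    by rewrite mulrC -ler_pdivrMr// mul1r lerBrDl.
  by rewrite in_itv/= andbT (lt_le_trans _ zs)// ltrDl.
Qed.

(** The sets whose preimage under a projection has the property form a sigma-algebra
    that contains the rays, hence all Borel sets of the line; measurable rectangles
    are intersections of two such preimages, and generate. *)
Lemma measurable_almost_continuous A : measurable A -> almost_continuous A.
Proof.
have [ac0 acD acU] := almost_continuous_sigma.
have pre (pr : T -> measurableTypeR R) : continuous (pr : R * R -> R) ->
    measurable_fun setT pr -> forall X, measurable X -> almost_continuous (pr @^-1` X).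
  move=> cpr mpr; pose C X := almost_continuous (pr @^-1` X).
  suff : measurable `<=` C by move=> h X; exact: h.
  rewrite [X in X `<=` _](_ : _ = (@RGenOInfty.G R).-sigma.-measurable); last first.
    exact: RGenOInfty.measurableE.
  apply: smallest_sub.
    split; rewrite /C; first by rewrite preimage_set0.
    - by move=> X CX; rewrite setTD preimage_setC -setTD; exact: acD.
    - by move=> X CX; rewrite preimage_bigcup; exact: acU.
  by move=> _ [s ->]; exact: almost_continuous_ray.
move: A; rewrite measurable_prod_measurableType; apply: smallest_sub => //.
move=> _ [X mX [Y mY <-]].
have -> : X `*` Y = ~` ((~` (fst @^-1` X)) `|` (~` (snd @^-1` Y))).
  by rewrite setCU !setCK.
apply: almost_continuousC; apply: almost_continuousU; apply: almost_continuousC.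
  by apply: pre => // z; exact: cvg_fst.
by apply: pre => // z; exact: cvg_snd.
Qed.
End almost_continuous.

Section Cont_dense.
Variables (R : realType) (a b c d : R) (p : R) (p1 : 1 <= p).
Local Notation K := (rect a b c d).
Local Notation mu := (rect_measure a b c d).
Local Notation T := (measurableTypeR R * measurableTypeR R)%type.
Local Notation N f := ('N[mu]_p%:E [EFin \o f%R])%E.
Implicit Types f : T -> R.

Let p0 : 0 < p. Proof. exact: lt_le_trans p1. Qed.

Lemma rect_measureC : mu (~` K) = 0.
Proof. by rewrite /rect_measure /mrestr setICl measure0. Qed.

Lemma measurable_Cont (g : Cont K R) : measurable_fun (setT : set T) (g : T -> R).
Proof. exact: Cont_measurable (measurable_rect a b c d). Qed.

Definition approximable f :=
  forall e, 0 < e -> exists g : Cont K R, (N (fun z => f z - g z) <= e%:E)%E.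

Lemma approximable_trans f : measurable_fun setT f ->
  (forall e, 0 < e -> exists h, [/\ measurable_fun setT h, approximable h &
    (N (fun z => f z - h z) <= e%:E)%E]) -> approximable f.
Proof.
move=> mf fh e e0; have e2 : 0 < e / 2 by rewrite divr_gt0.
have [h [mh ah fhe]] := fh _ e2; have [g hge] := ah _ e2.
exists g; rewrite (splitr e) EFinD; apply: le_trans (leeD fhe hge).
have m1 : measurable_fun setT (fun z => f z - h z) by exact: measurable_funB.
have m2 : measurable_fun setT (fun z => h z - g z).
  by apply: measurable_funB => //; exact: measurable_Cont.
have := minkowski_EFin mu m1 m2 p1.
by under [X in (X <= _)%E -> _]eq_Lnorm do rewrite /= subrKA.
Qed.

Lemma approximableD f h : measurable_fun setT f -> measurable_fun setT h ->
  approximable f -> approximable h -> approximable (fun z => f z + h z).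
Proof.
move=> mf mh af ah e e0; have e2 : 0 < e / 2 by rewrite divr_gt0.
have [g fge] := af _ e2; have [g' hge] := ah _ e2.
exists (g + g'); rewrite (splitr e) EFinD; apply: le_trans (leeD fge hge).
have m1 : measurable_fun setT (fun z => f z - g z).
  by apply: measurable_funB => //; exact: measurable_Cont.
have m2 : measurable_fun setT (fun z => h z - g' z).
  by apply: measurable_funB => //; exact: measurable_Cont.
have := minkowski_EFin mu m1 m2 p1.
rewrite [X in (X <= _)%E -> _](_ : _ = N (fun z => f z + h z - (g + g') z))//.
apply: eq_Lnorm => z; congr EFin.
change (f z - g z + (h z - g' z) = f z + h z - (g z + g' z)).
by rewrite opprD addrACA.
Qed.

Lemma approximableZ (k : R) f : measurable_fun setT f ->
  approximable f -> approximable (fun z => k * f z).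
Proof.
move=> mf af e e0; have k1 : 0 < `|k| + 1 by rewrite ltr_wpDl.
have [|g fge] := af (e / (`|k| + 1)); first by rewrite divr_gt0.
exists (k *: g).
have m1 : measurable_fun setT (fun z => f z - g z).
  by apply: measurable_funB => //; exact: measurable_Cont.
rewrite [X in (X <= _)%E](_ : _ = (`|k|%:E * N (fun z => (f z - g z)%R))%E); last first.
  rewrite -LnormMl//; apply: eq_Lnorm => z; congr EFin.
  by change (k * f z - k * g z = k * (f z - g z)); rewrite mulrBr.
apply: (@le_trans _ _ (`|k|%:E * (e / (`|k| + 1))%:E)%E).
  by apply: lee_pmul => //; exact: Lnorm_ge0.
rewrite -EFinM lee_fin mulrCA ler_piMr ?(ltW e0)//.
by rewrite ler_pdivrMr// mul1r lerDl.
Qed.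

Lemma approximable0 : approximable (fun=> 0).
Proof.
move=> e e0; exists 0; rewrite (_ : _ \o _ = cst 0%E); last first.
  by apply/funext => z; rewrite /= subr0.
by rewrite Lnorm0 ?lee_fin ?(ltW e0)// eqe gt_eqF.
Qed.

(** The difference with the continuous function is at most 1 in absolute value, and
    is 0 off [B] and the complement of the rectangle, which is a null set. *)
Lemma approximable_indic A : measurable A -> approximable (\1_A : T -> R).
Proof.
move=> mA e e0; have [_ /(_ (e `^ p))] := measurable_almost_continuous a b c d mA.
case=> [|g [B [mB Be g01 gE]]]; first by rewrite powR_gt0.
exists g; apply/(Lnorm_leP _ p1); first exact: ltW.
have mAC : measurable (B `|` ~` K).
  by apply: measurableU => //; apply: measurableC; exact: measurable_rect.
have mid : measurable_fun setT (fun z => (\1_(B `|` ~` K) z : R)%:E).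
  by apply/measurable_EFinP; exact: measurable_indic.
apply: (@le_trans _ _ (\int[mu]_z (\1_(B `|` ~` K) z : R)%:E)%E).
  apply: ge0_le_integral => //.
    apply: measurable_normr_powR; apply: measurable_funB; last exact: measurable_Cont.
    exact: measurable_indic.
  move=> z _; rewrite lee_fin.
  have h1 : `|\1_A z - g z : R| <= 1.
    have /andP[g0 g1] := g01 z; rewrite indicE ler_norml.
    by case: (z \in A) => /=; apply/andP; split; lra.
  have [zB|/not_orP[zB /contrapT Kz]] := pselect ((B `|` ~` K) z).
    have p1E : 1 `^ p = 1 :> R by rewrite powR1.
    rewrite [leRHS]indicE mem_set//=; have := ge0_ler_powR (ltW p0) _ _ h1.
    by rewrite p1E; apply; rewrite nnegrE.
  by rewrite gE// subrr normr0 powR0 ?gt_eqF// indicE.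
rewrite integral_indic// setIT.
apply: (@le_trans _ _ (mu B + mu (~` K))%E).
  by apply: measureU2 => //; apply: measurableC; exact: measurable_rect.
by rewrite rect_measureC adde0 ltW.
Qed.

Import HBNNSimple.

Lemma approximable_nnsfun (h : {nnsfun T >-> R}) : approximable h.
Proof.
rewrite (_ : (h : T -> R) = fun z =>
    \sum_(y <- finmap.enum_fset (fset_set (range h)))
      (y * \1_(h @^-1` [set y]) z)); last first.
  by apply/funext => z; rewrite fimfunE fsbig_finite.
elim: (finmap.enum_fset (fset_set (range h))) => [|y s IH].
  by under eq_fun do rewrite big_nil; exact: approximable0.
under eq_fun do rewrite big_cons.
have mi x : measurable_fun setT (\1_(h @^-1` [set x]) : T -> R).
  by apply: measurable_indic; exact: measurable_funPTI.
apply: approximableD => //.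
- exact: measurable_funM.
- by apply: measurable_sum => x; exact: measurable_funM.
- by apply: approximableZ => //; apply: approximable_indic; exact: measurable_funPTI.
Qed.

(** Simple functions increasing to [f] converge to it in L^p by dominated
    convergence, the error being at most [f]. *)
Lemma approximable_ge0 f : measurable_fun setT f -> (forall z, 0 <= f z) ->
  (N f < +oo)%E -> approximable f.
Proof.
move=> mf f0 Nf; apply: approximable_trans => // e e0.
have mf' : measurable_fun setT (EFin \o f) by exact/measurable_EFinP.
pose h := nnsfun_approx measurableT mf'.
have f0' z : setT z -> (0 <= (EFin \o f) z)%E by rewrite lee_fin.
have hf n z : h n z <= f z.
  by rewrite -lee_fin /h nnsfun_approxE; exact: le_approx.
have h_cvg z : f z - h n z @[n --> \oo] --> 0.
  have := cvg_nnsfun_approx measurableT mf' f0' (x := z) I.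
  move=> /fine_cvg /= hc; rewrite -(subrr (f z)); apply: cvgB => //.
  exact: cvg_cst.
have mh n : measurable_fun setT (h n) by exact: measurable_funPT.
have mfh n : measurable_fun setT (fun z => f z - h n z) by exact: measurable_funB.
have fh n z : `|f z - h n z| <= `|f z|.
  by rewrite !ger0_norm ?subr_ge0// gerBl.
have [n Nn] := dominated_Lnorm p1 mfh mf Nf fh h_cvg e0.
by exists (h n); split => //; exact: approximable_nnsfun.
Qed.

Lemma approximable_Lp f : measurable_fun setT f -> (N f < +oo)%E -> approximable f.
Proof.
move=> mf Nf.
rewrite (_ : f = fun z => Num.max (f z) 0 + (-1) * Num.max (- f z) 0); last first.
  apply/funext => z; rewrite mulN1r.
  by case: (lerP (f z) 0) => fz; case: (lerP (- f z) 0) => fz'; lra.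
have part (s : R) : `|s| = 1 -> measurable_fun setT (fun z => Num.max (s * f z) 0) /\
    approximable (fun z => Num.max (s * f z) 0).
  move=> s1; have mp : measurable_fun setT (fun z => Num.max (s * f z) 0).
    by apply: measurable_maxr => //; exact: measurable_funM.
  split => //; apply: approximable_ge0 => //.
    by move=> z; rewrite le_max lexx orbT.
  apply: le_lt_trans Nf; apply: (le_Lnorm mu p1) => // z.
  rewrite -[leRHS]mul1r -s1 -normrM.
  by case: (lerP (s * f z) 0) => _ //; rewrite normr0 normr_ge0.
have [m1 a1] := part 1 (normr1 _); have [|m2 a2] := part (-1); first by rewrite normrN1.
apply: approximableD.
- by under eq_fun do rewrite -(mul1r (f _)).
- by apply: measurable_funM => //; under eq_fun do rewrite -mulN1r.
- by under eq_fun do rewrite -(mul1r (f _)).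
- by apply: approximableZ; under eq_fun do rewrite -mulN1r.
Qed.

(** Real and imaginary parts are approximated separately, the modulus being at most
    the sum of the absolute values of the two parts. *)
Lemma Cont_Lp_dense (w : Lp mu p1) e : 0 < e ->
  exists g : Cont K R[i], Lp_nrm (w - Cont_Lp p1 g) < e.
Proof.
move=> e0; have e3 : 0 < e / 3 by rewrite divr_gt0.
pose f := repr w; have [mR mI Nf] := Lp_funP f.
have mn := Lp_fun_normc f.
have NR : (N (fun z => Re (f z)) < +oo)%E.
  apply: le_lt_trans Nf; apply: (le_Lnorm mu p1) => // z.
  by rewrite [leRHS]ger0_norm ?normc_ge0// normr_Re.
have NI : (N (fun z => Im (f z)) < +oo)%E.
  apply: le_lt_trans Nf; apply: (le_Lnorm mu p1) => // z.
  by rewrite [leRHS]ger0_norm ?normc_ge0// normr_Im.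
have [g gR] := approximable_Lp mR NR e3; have [h hI] := approximable_Lp mI NI e3.
exists (Cont_complex g h); rewrite -lte_fin Lp_nrmE -[w]Lp_class_repr -Lp_classB.
rewrite Lp_norm_class; have m1 : measurable_fun setT (fun z => `|Re (f z) - g z|).
  by apply: measurableT_comp => //; apply: measurable_funB => //; exact: measurable_Cont.
have m2 : measurable_fun setT (fun z => `|Im (f z) - h z|).
  by apply: measurableT_comp => //; apply: measurable_funB => //; exact: measurable_Cont.
apply: (@le_lt_trans _ _ (e / 3 + e / 3)%:E); last by rewrite lte_fin; lra.
rewrite EFinD.
rewrite -Lnorm_abse in gR; rewrite -Lnorm_abse in hI.
apply: (le_trans _ (leeD gR hI)).
apply: (le_trans _ (minkowski_EFin mu m1 m2 p1)).
apply: (le_Lnorm mu p1).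
- exact: Lp_fun_normc.
- exact: measurable_funD.
move=> z; rewrite ger0_norm ?normc_ge0// ger0_norm ?addr_ge0 ?normr_ge0//.
change (normc (f z - (g z +i* h z)%C) <= `|Re (f z) - g z| + `|Im (f z) - h z|).
exact: normcB_le.
Qed.
End Cont_dense.

(** * Norms of continuous functions *)

Section Cont_norms.
Variables (R : realType) (a b c d : R) (p : R) (p1 : 1 <= p).
Local Notation K := (rect a b c d).
Local Notation mu := (rect_measure a b c d).
Implicit Types (f g : Cont K R) (h : Cont K R[i]).

Lemma Cont_ext (V : numFieldType) (u v : Cont K V) : (forall z, u z = v z) -> u = v.
Proof. by move=> uv; apply/val_inj/funext. Qed.

Lemma Cont_normR_scale (r : R) f : Cont_normR p (r *: f) = (`|r|%:E * Cont_normR p f)%E.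
Proof. by rewrite /Cont_normR -LnormMl//; exact: measurable_Cont. Qed.

Lemma Lp_norm_Cont h : Lp_norm (Cont_Lp p1 h) = Cont_normC p h.
Proof. by rewrite Lp_norm_class. Qed.

Lemma Cont_Lp_linear : linear (Cont_Lp p1 : Cont K R[i] -> Lp mu p1).
Proof.
move=> k f g; transitivity (Lp_scale k (Cont_Lp p1 f) + Cont_Lp p1 g) => //.
rewrite /Cont_Lp -Lp_classZ -Lp_classD.
by apply/Lp_classP; exact: aeW.
Qed.

Lemma Cont_normC_fin h : Cont_normC p h \is a fin_num.
Proof. by rewrite -Lp_norm_Cont -Lp_nrmE. Qed.

Lemma measurable_normc_Cont h :
  measurable_fun (setT : set (measurableTypeR R * measurableTypeR R))
    (fun z => normc (h z)).
Proof.
apply: measurable_normc; first exact: (measurable_Cont (Cont_Re h)).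
exact: (measurable_Cont (Cont_Im h)).
Qed.

Lemma Cont_normR_Re h : (Cont_normR p (Cont_Re h) <= Cont_normC p h)%E.
Proof.
apply: le_Lnorm => //; [exact: measurable_Cont|exact: measurable_normc_Cont|move=> z].
by rewrite [leRHS]ger0_norm ?normc_ge0// normr_Re.
Qed.

Lemma Cont_normR_Im h : (Cont_normR p (Cont_Im h) <= Cont_normC p h)%E.
Proof.
apply: le_Lnorm => //; [exact: measurable_Cont|exact: measurable_normc_Cont|move=> z].
by rewrite [leRHS]ger0_norm ?normc_ge0// normr_Im.
Qed.

Lemma Cont_normC_real f : Cont_normC p (Cont_complex f 0) = Cont_normR p f.
Proof.
apply/eqP; rewrite eq_le; apply/andP; split; apply: le_Lnorm => //;
  try (by apply: measurable_normc; exact: measurable_Cont); try exact: measurable_Cont.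
  by move=> z; rewrite /= expr0n addr0 sqrtr_sqr normr_id.
by move=> z; rewrite /= expr0n addr0 sqrtr_sqr normr_id.
Qed.

Lemma Cont_normR_fin f : Cont_normR p f \is a fin_num.
Proof. by rewrite -Cont_normC_real; exact: Cont_normC_fin. Qed.
End Cont_norms.

(** * The folding map of a net *)

Section affine.
Variable R : realType.
Local Notation lambda := (@lebesgue_measure R).

(** By uniqueness of Lebesgue measure, half-open intervals suffice; a negative slope
    makes them open at the other end, which leaves their length unchanged. *)
Lemma lebesgue_measure_affine (k m : R) (A : set (measurableTypeR R)) :
  k != 0 -> measurable A ->
  lambda ((fun s => k * s + m) @^-1` A) = (`|k|^-1%:E * lambda A)%E.
Proof.
move=> k0 mA; pose f : measurableTypeR R -> measurableTypeR R := fun s => k * s + m.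
have mf : measurable_fun setT f.
  by apply: measurable_funD => //; exact: measurable_funM.
have n0 : `|k|%:E != 0%E by rewrite eqe normr_eq0.
rewrite (@lebesgue_measure_unique R
  (mscale (NngNum (normr_ge0 k)) (pushforward lambda f)) _ A mA) => [|X [[u v] _ <-]].
  rewrite /mscale /= /pushforward muleA -EFinM mulVf ?mul1e//.
rewrite /= lebesgue_measure_itv /mscale /= /pushforward.
have [k_gt0|k_lt0] : 0 < k \/ k < 0.
  by move: k0; rewrite neq_lt => /orP[]; [right|left].
  rewrite [X in lambda X](_ : _ = `](u - m) / k, (v - m) / k]%classic); last first.
    apply/seteqP; split => s /=; rewrite !in_itv/= /f;
      by rewrite ltr_pdivrMr// ler_pdivlMr// ltrBlDr lerBrDr (mulrC s).
  rewrite lebesgue_measure_itv/= !lte_fin ltr_pM2r ?invr_gt0// ltrD2r.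
  case: ifPn => uv; last by rewrite mule0.
  rewrite -!EFinB -EFinM ger0_norm ?(ltW k_gt0)//; congr EFin; field.
  by rewrite gt_eqF.
rewrite [X in lambda X](_ : _ = `[(v - m) / k, (u - m) / k[%classic); last first.
  apply/seteqP; split => s /=; rewrite !in_itv/= /f;
    by rewrite ltr_ndivlMr// ler_ndivrMr// ltrBlDr lerBrDr (mulrC s) andbC.
rewrite lebesgue_measure_itv/= !lte_fin ltr_nM2r ?invr_lt0// ltrD2r.
case: ifPn => uv; last by rewrite mule0.
rewrite -!EFinB -EFinM ler0_norm ?(ltW k_lt0)//; congr EFin; field.
by rewrite lt_eqF.
Qed.
End affine.

Section net.
Variables (R : realType) (x : nat -> R) (N : nat).
Hypothesis hx : forall i, (i < N)%N -> x i < x i.+1.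
Local Notation lambda := (@lebesgue_measure R).

Lemma net_le i j : (i <= j <= N)%N -> x i <= x j.
Proof.
elim: j => [|j IH]; first by rewrite leqn0 => /andP[/eqP->].
rewrite leq_eqVlt ltnS => /andP[/predU1P[->//|ij] jN].
by rewrite (le_trans (IH _)) ?ij ?(ltnW jN)// ltW// hx.
Qed.

Lemma net_lt : (0 < N)%N -> x 0%N < x N.
Proof.
by move=> N0; rewrite (lt_le_trans (hx N0))// net_le// N0 leqnn.
Qed.

Lemma net_cover s : x 0%N <= s <= x N -> (0 < N)%N ->
  exists2 i, (1 <= i <= N)%N & x i.-1 <= s <= x i.
Proof.
move=> /andP[s0 sN] N0.
have [n nP nmin] := ex_minnP (ex_intro (fun i => is_true (s <= x i)) N sN).
case: n nP nmin => [|n] nP nmin.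
  exists 1%N; rewrite ?N0//= s0 (le_trans nP)//; exact/ltW/hx.
exists n.+1; first by rewrite /= nmin.
by rewrite nP andbT leNgt; apply/negP => /ltW/nmin; rewrite ltnn.
Qed.

(** The piecewise affine map that equals [net_inv x N i] on the i-th cell, written as
    a sum of clamps so that continuity needs no gluing. *)
Definition fold_map s : R :=
  x 0%N + \sum_(i < N) (-1) ^+ i * ((x N - x 0%N) / (x i.+1 - x i)) *
                       (clamp (x i) (x i.+1) s - x i).

Lemma fold_map_continuous : continuous fold_map.
Proof.
move=> s; apply: cvgD; first exact: cvg_cst.
elim: (index_enum _) => [|i r IH].
  by rewrite big_nil; under eq_fun do rewrite big_nil; exact: cvg_cst.
rewrite big_cons; under eq_fun do rewrite big_cons.
apply: cvgD => //; apply: cvgM; first exact: cvg_cst.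
by apply: cvgB; [exact: clamp_continuous|exact: cvg_cst].
Qed.

(** On the cell of index [k.+1] the earlier clamps are saturated and contribute
    [x N - x 0%N] with alternating signs, in total [x N - x 0%N] or 0 according to the
    parity of [k]; the later ones contribute 0. *)
Lemma fold_mapE i s : (1 <= i <= N)%N -> x i.-1 <= s <= x i ->
  fold_map s = net_inv x N i s.
Proof.
case: i => [//|k] /andP[_ kN] /andP[sk sk1]; rewrite /= in sk.
pose t i := (-1) ^+ i * ((x N - x 0%N) / (x i.+1 - x i)) *
  (clamp (x i) (x i.+1) s - x i).
rewrite /fold_map -(big_mkord xpredT t) (@big_cat_nat _ _ _ k)//=; last exact: ltnW.
rewrite [X in _ + (_ + X)]big_ltn//= {2}/t clamp_id ?sk//.
have -> : \sum_(k.+1 <= j < N) t j = 0.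
  rewrite big_nat_cond big1// => j /andP[/andP[kj jN] _].
  rewrite /t clamp_le ?subrr ?mulr0//; first by rewrite ltW// hx.
  by rewrite (le_trans sk1)// net_le// kj ltnW.
have -> : \sum_(0 <= j < k) t j = (odd k)%:R * (x N - x 0%N).
  elim: k kN sk {sk1} => [|k IH] kN sk; first by rewrite big_nil mul0r.
  have xk : x k < x k.+1 by rewrite hx// ltnW.
  rewrite big_nat_recr//= IH ?(ltnW kN)//; last by rewrite (le_trans _ sk)// ltW.
  rewrite /t clamp_ge ?(ltW xk)// -mulrA divfK ?subr_eq0 ?gt_eqF// -signr_odd.
  by case: (odd k); rewrite /= ?expr0 ?expr1; ring.
have xk : x k < x k.+1 by rewrite hx.
rewrite /net_inv /affine_map -signr_odd /=.
case: (odd k); rewrite /= ?expr0 ?expr1; field.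
  by rewrite !subr_eq0 (lt_eqF xk) (gt_eqF xk).
by rewrite subr_eq0 gt_eqF.
Qed.

Lemma net_inv_in i s : (1 <= i <= N)%N -> x i.-1 <= s <= x i ->
  x 0%N <= net_inv x N i s <= x N.
Proof.
case: i => [//|k] /andP[_ kN] /andP[sk sk1]; rewrite /= in sk.
have xk : x k < x k.+1 by rewrite hx.
have xN : x 0%N < x N by rewrite net_lt// (leq_ltn_trans _ kN).
rewrite /net_inv /affine_map /=.
pose r := (s - x k) / (x k.+1 - x k).
have r0 : 0 <= r by rewrite divr_ge0 ?subr_ge0// ltW.
have r1 : r <= 1 by rewrite ler_pdivrMr ?subr_gt0// mul1r lerD2r.
case: (odd k) => /=.
  have -> : x 0%N + (x N - x 0%N) / (x k - x k.+1) * (s - x k.+1) =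
      x 0%N + (x N - x 0%N) * (1 - r).
    by rewrite /r; field; rewrite !subr_eq0 (lt_eqF xk) (gt_eqF xk).
  by apply/andP; split; nra.
have -> : x 0%N + (x N - x 0%N) / (x k.+1 - x k) * (s - x k) =
    x 0%N + (x N - x 0%N) * r by rewrite /r; field; rewrite subr_eq0 gt_eqF.
by apply/andP; split; nra.
Qed.

Lemma fold_map_in s : (0 < N)%N -> x 0%N <= s <= x N -> x 0%N <= fold_map s <= x N.
Proof.
move=> N0 sI; have [i iN si] := net_cover sI N0.
by rewrite (fold_mapE iN si); exact: net_inv_in.
Qed.
End net.

Section net_measure.
Variables (R : realType) (x : nat -> R) (N : nat).
Hypothesis hx : forall i, (i < N)%N -> x i < x i.+1.
Hypothesis N0 : (0 < N)%N.
Local Notation lambda := (@lebesgue_measure R).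
Local Notation P := (fold_map x N : measurableTypeR R -> measurableTypeR R).
Implicit Types A B : set (measurableTypeR R).

Lemma measurable_fold_map : measurable_fun setT P.
Proof. by apply: continuous_measurable_fun; exact: fold_map_continuous. Qed.

Lemma measurable_fold_map_preimage A : measurable A -> measurable (P @^-1` A).
Proof. by move=> mA; rewrite -[X in measurable X]setTI; exact: measurable_fold_map. Qed.

(** No point outside the cell is sent into the whole interval by [net_inv], because
    the inverse of that map sends the interval into the cell. *)
Lemma fold_map_cell i A : (i < N)%N ->
  `[x i, x i.+1] `&` P @^-1` A = net_inv x N i.+1 @^-1` (`[x 0%N, x N] `&` A).
Proof.
move=> iN; have xi : x i < x i.+1 by exact: hx.
have xN : x 0%N < x N by exact: net_lt.
have i1 : (1 <= i.+1 <= N)%N by rewrite ltn0Sn.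
have x0N : x 0%N != x N by rewrite lt_eqF.
apply/seteqP; split => [s [/=]|s [/=]]; rewrite !in_itv/= => si sA.
  have := net_inv_in hx i1 si; split => //.
  by rewrite -(fold_mapE hx i1 si).
suff ci : x i <= s <= x i.+1.
  by split; rewrite /= ?in_itv//= (fold_mapE hx i1 ci).
rewrite -(@net_invK _ x N i.+1 x0N _ s) ?lt_eqF//.
move: si; set r := net_inv _ _ _ _ => /andP[r0 rN].
rewrite /net_map /affine_map.
pose q := (r - x 0%N) / (x N - x 0%N).
have q0 : 0 <= q by rewrite divr_ge0 ?subr_ge0// ltW.
have q1 : q <= 1 by rewrite ler_pdivrMr ?subr_gt0// mul1r lerD2r.
case: ifP => _ /=.
  rewrite -mulrA (mulrC _ (r - _)) -/q; nra.
rewrite -mulrA (mulrC _ (r - _)) -/q; nra.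
Qed.

Lemma lebesgue_measure_cell i A : (i < N)%N -> measurable A ->
  lambda (`[x i, x i.+1] `&` P @^-1` A) =
  (((x i.+1 - x i) / (x N - x 0%N))%:E * lambda (`[x 0%N, x N] `&` A))%E.
Proof.
move=> iN mA; have xi : x i < x i.+1 by exact: hx.
have xN : x 0%N < x N by exact: net_lt.
have mIA : measurable (`[x 0%N, x N] `&` A).
  by apply: measurableI => //; exact: measurable_itv.
rewrite fold_map_cell//.
have inv_affine s t s' t' : s != t -> s' != t' ->
    lambda (affine_map s t s' t' @^-1` (`[x 0%N, x N] `&` A)) =
    (`|(t - s) / (t' - s')|%:E * lambda (`[x 0%N, x N] `&` A))%E.
  move=> st st'; have k0 : (t' - s') / (t - s) != 0.
    by rewrite mulf_neq0// ?invr_eq0 subr_eq0 eq_sym.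
  rewrite -invf_div normfV -(lebesgue_measure_affine (s' - (t' - s') / (t - s) * s))//.
  suff -> : affine_map s t s' t' = (fun r =>
    (t' - s') / (t - s) * r + (s' - (t' - s') / (t - s) * s)) by [].
  by apply/funext => r; rewrite /affine_map; ring.
have n1 : x i != x i.+1 by rewrite lt_eqF.
have n2 : x 0%N != x N by rewrite lt_eqF.
rewrite /net_inv; case: ifP => _; rewrite inv_affine// 1?eq_sym//.
  by rewrite ger0_norm// divr_ge0// subr_ge0 ltW.
by rewrite -opprB mulNr normrN ger0_norm// divr_ge0// subr_ge0 ltW.
Qed.

(** Each cell contributes its share of the mass of the whole interval, because the map
    is an affine bijection from the cell onto the interval. *)
Lemma lebesgue_measure_fold_map A : measurable A ->
  lambda (`[x 0%N, x N] `&` P @^-1` A) = lambda (`[x 0%N, x N] `&` A).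
Proof.
move=> mA; have xN : x 0%N < x N by exact: net_lt.
have mP := measurable_fold_map_preimage mA.
suff h n : (n <= N)%N -> lambda (`[x 0%N, x n] `&` P @^-1` A) =
    (((x n - x 0%N) / (x N - x 0%N))%:E * lambda (`[x 0%N, x N] `&` A))%E.
  by rewrite h// divff ?mul1e// subr_eq0 gt_eqF.
have null r B : measurable B -> lambda ([set r] `&` B) = 0%E.
  move=> mB; apply: (@subset_measure0 _ _ _ lambda _ [set r]) => //.
  - by apply: measurableI => //; exact: measurable_set1.
  - exact: lebesgue_measure_set1.
elim: n => [_|n IH nN].
  by rewrite subrr mul0r mul0e set_itv1 null.
have xn : x n < x n.+1 by exact: hx.
have x0n : x 0%N <= x n by rewrite (net_le hx)//= ltnW.
have mI (i : interval R) : measurable ([set` i] `&` P @^-1` A).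
  by apply: measurableI => //; exact: measurable_itv.
have mS r : measurable ([set r] `&` P @^-1` A).
  by apply: measurableI => //; exact: measurable_set1.
have addU (U V : set (measurableTypeR R)) : measurable U -> measurable V ->
    U `&` V = set0 -> lambda (U `|` V) = (lambda U + lambda V)%E.
  by move=> mU mV UV; exact: measureU.
(* Adjacent closed cells overlap in a single point, which is a null set. *)
have cell : lambda (`]x n, x n.+1] `&` P @^-1` A) =
    lambda (`[x n, x n.+1] `&` P @^-1` A).
  rewrite -(@setU1itv _ _ (BRight (x n.+1)) (x n) false) ?bnd_simp ?ltW// setIUl.
  rewrite addU; [by rewrite null// add0e|exact: mS|exact: mI|].
  by rewrite -subset0 => s [[/= -> _] [/=]]; rewrite in_itv/= ltxx.
rewrite (@itv_bndbnd_setU _ _ _ (BRight (x n)) _) ?bnd_simp//; last exact: ltW.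
rewrite setIUl addU; [|exact: mI|exact: mI|]; last first.
  rewrite -subset0 => s [[/=]]; rewrite in_itv/= => /andP[_ sn] _ [/=].
  by rewrite in_itv/= ltNge sn.
rewrite IH ?(ltnW nN)// cell lebesgue_measure_cell// -ge0_muleDl ?lee_fin.
  - by rewrite -EFinD -mulrDl addrC subrKA.
  - by rewrite divr_ge0 ?subr_ge0// ltW.
  - by rewrite divr_ge0 ?subr_ge0// ltW.
Qed.
End net_measure.

Section net_measure2.
Variables (R : realType) (x y : nat -> R) (N M : nat).
Hypotheses (hx : forall i, (i < N)%N -> x i < x i.+1) (N0 : (0 < N)%N).
Hypotheses (hy : forall j, (j < M)%N -> y j < y j.+1) (M0 : (0 < M)%N).
Local Notation T := (measurableTypeR R * measurableTypeR R)%type.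
Local Notation K := (net_rect x N y M).
Local Notation mu := (net_measure x N y M).

Definition fold_map2 (z : R * R) : R * R := (fold_map x N z.1, fold_map y M z.2).

Lemma fold_map2_continuous : continuous fold_map2.
Proof.
have c1 : continuous (fun w : R * R => fold_map x N w.1).
  move=> w; apply: (@continuous_comp _ _ _ (fun w : R * R => w.1) (fold_map x N)).
    exact: cvg_fst.
  exact: fold_map_continuous.
have c2 : continuous (fun w : R * R => fold_map y M w.2).
  move=> w; apply: (@continuous_comp _ _ _ (fun w : R * R => w.2) (fold_map y M)).
    exact: cvg_snd.
  exact: fold_map_continuous.
move=> z.
exact: (@cvg_pair _ _ _ (nbhs z) (nbhs (fold_map x N z.1))
  (nbhs (fold_map y M z.2)) _ _ _ _ _ (c1 z) (c2 z)).
Qed.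

Lemma fold_map2_in z : K z -> K (fold_map2 z).
Proof.
move=> [] /=; rewrite !in_itv/= => z1 z2.
by split; rewrite /= in_itv/=; exact: fold_map_in.
Qed.

Lemma measurable_fold_map2 : measurable_fun setT (fold_map2 : T -> T).
Proof.
apply/measurable_fun_pairP; split.
  apply: (@measurableT_comp _ _ _ _ _ _
    (fold_map x N : measurableTypeR R -> measurableTypeR R)) => //.
  exact: measurable_fold_map.
apply: (@measurableT_comp _ _ _ _ _ _
  (fold_map y M : measurableTypeR R -> measurableTypeR R)) => //.
exact: measurable_fold_map.
Qed.

Lemma net_measureX (A B : set (measurableTypeR R)) : measurable A -> measurable B ->
  mu (A `*` B) = (lebesgue_measure (`[x 0%N, x N] `&` A) *
                  lebesgue_measure (`[y 0%N, y M] `&` B))%E.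
Proof.
move=> mA mB; rewrite /rect_measure /mrestr /rect.
rewrite (_ : (A `*` B) `&` _ = (`[x 0%N, x N] `&` A) `*` (`[y 0%N, y M] `&` B)).
  by rewrite product_measure1E//; apply: measurableI => //; exact: measurable_itv.
by rewrite setIC -setXI.
Qed.

(** Two finite measures that agree on measurable rectangles, where both are products
    of one-dimensional measures. *)
Lemma net_measure_fold_map2 (A : set T) : measurable A ->
  mu (fold_map2 @^-1` A) = mu A.
Proof.
move=> mA; have mf := measurable_fold_map2.
suff : mu A = (pushforward mu (fold_map2 : T -> T)) A by [].
have := @measure_unique _ R T [set A `*` B | A in measurable & B in measurable]
  (fun=> setT) (measurable_prod_measurableType _ _) _ _ _ mu
  (pushforward mu (fold_map2 : T -> T)).
apply => //.
- move=> _ _ [A1 mA1 [B1 mB1 <-]] [A2 mA2 [B2 mB2 <-]].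
  exists (A1 `&` A2); first exact: measurableI.
  exists (B1 `&` B2); first exact: measurableI.
  by rewrite setXI.
- move=> _; exists setT => //; exists setT => //; exact: setXTT.
- by rewrite bigcup_const.
- move=> _ [A1 mA1 [B1 mB1 <-]].
  change (mu (A1 `*` B1) = mu ((fold_map x N @^-1` A1) `*` (fold_map y M @^-1` B1))).
  rewrite !net_measureX//; try exact: measurable_fold_map_preimage.
  by rewrite !lebesgue_measure_fold_map.
- move=> _; exact: rect_measure_lty.
Qed.

Lemma Lnorm_fold_map2 (p : R) (h : T -> R) : measurable_fun setT h ->
  ('N[mu]_p%:E [EFin \o (h \o fold_map2)] = 'N[mu]_p%:E [EFin \o h])%E.
Proof.
move=> mh; rewrite unlock /=; congr (_ `^ _)%E.
have mf := measurable_fold_map2.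
have mhp : measurable_fun setT (fun z => (`|h z| `^ p)%:E).
  apply/measurable_EFinP.
  apply: (@measurableT_comp _ _ _ _ _ _ (fun x : R => x `^ p)) => //.
  exact: measurableT_comp.
have := @ge0_integral_pushforward _ _ _ _ R _ mf mu setT
  (fun z => (`|h z| `^ p)%:E) measurableT mhp.
rewrite preimage_setT => <-; last by move=> z _; rewrite lee_fin powR_ge0.
apply: eq_measure_integral => A mA _; exact: net_measure_fold_map2.
Qed.
End net_measure2.

(** * Fixed points of weighted composition operators *)

Section contraction.
Variables (R : realType) (a b c d : R).
Local Notation K := (rect a b c d).
Variables (phi : R * R -> R * R) (alpha : Cont K R) (q : R).
Hypotheses (phi_cont : continuous phi) (phiK : forall z, K z -> K (phi z)).
Hypotheses (alpha_le : forall z, `|alpha z : R| <= q) (q1 : q < 1).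

Let q0 : 0 <= q. Proof. exact: le_trans (normr_ge0 _) (alpha_le (0, 0)). Qed.

Lemma within_comp (h : Cont K R) : {within K, continuous (fun z => h (phi z) : R^o)}.
Proof.
have /subspace_continuousP ch := (ContP h).1.
apply/subspace_continuousP => z Kz U /(ch _ (phiK Kz)) hU.
change (nbhs z (fun w => K w -> U (h (phi w)))).
have hU1 : nbhs (phi z) (fun w => K w -> U (h w)) by exact: hU.
have hU2 : nbhs z (fun w => K (phi w) -> U (h (phi w))) := @phi_cont z _ hU1.
by apply: filterS hU2 => w hw Kw; exact: hw (phiK Kw).
Qed.

Lemma expr_geometric_lt C e : 0 < e -> exists n, C * q ^+ n < e.
Proof.
move=> e0; have q1' : `|q| < 1 by rewrite ger0_norm.
have /cvgrPdist_lt/(_ e e0)[n _ /(_ n (leqnn n))] := @cvg_geometric _ C _ q1'.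
by rewrite sub0r normrN => h; exists n; exact: le_lt_trans (ler_norm _) h.
Qed.

(** Iterating the second inequality along the orbit of [z] gives
    [`|D z| <= C * q ^+ n] for all [n]. *)
Lemma contraction_eq0 (D : R * R -> R) C : (forall z, K z -> `|D z| <= C) ->
  (forall z, K z -> `|D z| <= q * `|D (phi z)|) -> forall z, K z -> D z = 0.
Proof.
move=> DC Dq z Kz.
have Dn n : forall w, K w -> `|D w| <= C * q ^+ n.
  elim: n => [|n IH] w Kw; first by rewrite expr0 mulr1 DC.
  by rewrite (le_trans (Dq w Kw))// exprS mulrCA ler_wpM2l// IH//; exact: phiK.
apply/eqP; rewrite -normr_eq0 eq_le normr_ge0 andbT; apply/ler_addgt0Pr => e e0.
have [n Cn] := expr_geometric_lt C e0.
by rewrite add0r (le_trans (Dn n z Kz))// ltW.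
Qed.

Lemma contraction_unique (f g g' : Cont K R) :
  (forall z, K z -> g z = (f z : R) + alpha z * g (phi z)) ->
  (forall z, K z -> g' z = (f z : R) + alpha z * g' (phi z)) -> g = g'.
Proof.
move=> gE g'E; have [B gB] := Cont_bounded g; have [B' gB'] := Cont_bounded g'.
apply/val_inj/funext => z; change (g z = g' z).
have [Kz|Kz] := pselect (K z); last first.
  by rewrite !Cont_out.
apply/eqP; rewrite -subr_eq0; apply/eqP.
apply: (@contraction_eq0 (fun z => (g z : R) - g' z) (B + B')) => // w Kw.
  by rewrite (le_trans (ler_normB _ _))// lerD.
rewrite gE// g'E// opprD addrACA subrr add0r -mulrBr normrM.
by rewrite ler_wpM2r.
Qed.

(** The iterates of the contraction started at 0 converge uniformly on [K], so
    that the limit is continuous. *)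
Lemma contraction_exists (f : Cont K R) :
  exists g : Cont K R, forall z, K z -> g z = (f z : R) + alpha z * g (phi z).
Proof.
have [B0 fB0] := Cont_bounded f.
pose B := Num.max B0 0; have B_ge0 : 0 <= B by rewrite le_max lexx orbT.
have fB z : `|f z : R| <= B by rewrite le_max fB0.
have step_cont (h : Cont K R) :
    {within K, continuous (fun z => (f z : R) + (alpha z : R) * h (phi z) : R^o)}.
  move=> z; apply: cvgD; first exact: (ContP f).1.
  apply: cvgM; first exact: (ContP alpha).1.
  exact: within_comp.
pose s n : Cont K R := iter n (fun h => Cont_restr (step_cont h)) 0.
have s0 z : s 0%N z = 0 :> R by [].
have sS n z : K z -> s n.+1 z = (f z : R) + alpha z * s n (phi z).
  by move=> Kz; rewrite /s iterS Cont_restr_in.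
(* The bound of all iterates: the solution of [B + q * C = C]. *)
pose C := B / (1 - q).
have C0 : 0 <= C by rewrite divr_ge0// subr_ge0 ltW.
have CE : B + q * C = C by rewrite /C; field; rewrite subr_eq0 gt_eqF.
have sC n z : K z -> `|s n z : R| <= C.
  elim: n z => [|n IH] z Kz; first by rewrite s0 normr0.
  rewrite sS// -CE (le_trans (ler_normD _ _))// lerD// normrM ler_pM//.
  exact: IH (phiK Kz).
have sB n z : K z -> `|(s n.+1 z : R) - s n z| <= B * q ^+ n.
  elim: n z => [|n IH] z Kz; first by rewrite sS// s0 mulr0 addr0 subr0 expr0 mulr1.
  rewrite (sS n.+1 z Kz) (sS n z Kz) opprD addrACA subrr add0r -mulrBr normrM exprS mulrCA.
  by rewrite ler_pM// IH//; exact: phiK.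
pose g0 z : R := limn (fun n => s n z : R).
have cs z : K z -> (s n z : R) @[n --> \oo] --> g0 z.
  move=> Kz; apply: (@cvgn_summable_increments _ (fun n => s n z) (geometric B q)).
    by move=> n; exact: sB.
  by apply: is_cvg_geometric_series; rewrite ger0_norm.
have g0E z : K z -> g0 z = (f z : R) + alpha z * g0 (phi z).
  move=> Kz; have c1 := cs z Kz; rewrite -(cvg_shiftS (fun n => s n z : R)) in c1.
  have c2 : (f z : R) + alpha z * s n (phi z) @[n --> \oo] -->
      (f z : R) + alpha z * g0 (phi z).
    apply: cvgD; first exact: cvg_cst.
    by apply: cvgM; [exact: cvg_cst|exact: cs (phiK Kz)].
  have E : (fun n => s n.+1 z : R) = (fun n => (f z : R) + alpha z * s n (phi z)).
    by apply/funext => n; exact: sS.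
  by rewrite -(cvg_lim _ c2)// -E; apply/esym/(cvg_lim _ c1).
have g0C z : K z -> `|g0 z| <= C.
  move=> Kz; have /cvg_norm cn := cs z Kz; rewrite -(cvg_lim _ cn)//.
  by apply: limr_le; [apply/cvg_ex; eexists; exact: cn|apply: nearW => n; exact: sC].
have tail n : forall z, K z -> `|g0 z - s n z| <= C * q ^+ n.
  elim: n => [|n IH] z Kz; first by rewrite s0 subr0 expr0 mulr1 g0C.
  rewrite g0E// sS// opprD addrACA subrr add0r -mulrBr normrM exprS mulrCA.
  by rewrite ler_pM// IH//; exact: phiK.
have cg0 : {within K, continuous (g0 : R * R -> R^o)}.
  apply/subspace_continuousP => z Kz; apply/cvgrPdist_lt => e e0.
  have e3 : 0 < e / 3 by rewrite divr_gt0.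
  have [n Cn] := expr_geometric_lt C e3.
  have /subspace_continuousP/(_ z Kz)/cvgrPdist_lt/(_ _ e3) sn := (ContP (s n)).1.
  have {}sn : nbhs z (fun w => K w -> `|(s n z : R) - s n w| < e / 3) := sn.
  change (nbhs z (fun w => K w -> `|g0 z - g0 w| < e)).
  apply: filterS sn => w hw Kw; have {hw} := hw Kw.
  have := tail n z Kz; have := tail n w Kw.
  move: (s n z : R) (s n w : R) => u v; rewrite !ler_norml !ltr_norml.
  move=> /andP[w1 w2] /andP[z1 z2] /andP[h1 h2]; apply/andP; split; lra.
exists (Cont_restr cg0) => z Kz.
by rewrite (Cont_restr_in cg0 Kz) (Cont_restr_in cg0 (phiK Kz)) g0E.
Qed.
End contraction.

(** * The fractal operator *)

Section fractal.
Variables (R : realType) (N M : nat) (x y : nat -> R).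
Hypotheses (hx : forall i, (i < N)%N -> x i < x i.+1) (N0 : (0 < N)%N).
Hypotheses (hy : forall j, (j < M)%N -> y j < y j.+1) (M0 : (0 < M)%N).
Local Notation K := (net_rect x N y M).
Local Notation mu := (net_measure x N y M).
Local Notation T := (measurableTypeR R * measurableTypeR R)%type.
Local Notation phi := (fold_map2 x y N M).
Variables (alpha : Cont K R) (L : {linear Cont K R -> Cont K R}).
Hypothesis alpha_lt1 : (supnorm alpha < 1)%E.
Local Notation F := (fractal_op x N y M alpha L).

Lemma supnorm_lt1 : exists q : R, q < 1 /\ forall z, `|alpha z : R| <= q.
Proof.
have K0 : K (x 0%N, y 0%N).
  by split; rewrite /= in_itv/= lexx ltW// net_lt.
have up z : K z -> (`|alpha z|%:E <= supnorm alpha)%E.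
  by move=> Kz; apply: ereal_sup_ubound; exists z.
have s0 : (0 <= supnorm alpha)%E by apply: le_trans (up _ K0); rewrite lee_fin.
have sfin : supnorm alpha \is a fin_num.
  by rewrite ge0_fin_numE// (lt_trans alpha_lt1)// ltry.
exists (fine (supnorm alpha)); split; first by rewrite -lte_fin fineK.
move=> z; have [Kz|Kz] := pselect (K z); first by rewrite -lee_fin fineK// up.
by rewrite Cont_out// normr0 fine_ge0.
Qed.

(** The folding map turns the equations on the cells into a single equation on the
    rectangle, since the cells cover it and the folding map inverts each cell map. *)
Lemma fractalP (f g : Cont K R) : is_alpha_fractal x N y M alpha L f g <->
  forall z, K z ->
    g z = (f z : R) - (alpha z : R) * L f (phi z) + alpha z * g (phi z).
Proof.
have cell s t : K (s, t) -> exists i j, [/\ (1 <= i <= N)%N, (1 <= j <= M)%N,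
    x i.-1 <= s <= x i & y j.-1 <= t <= y j].
  move=> [/=]; rewrite !in_itv/= => sI tJ.
  have [i iN si] := net_cover hx sI N0; have [j jM tj] := net_cover hy tJ M0.
  by exists i, j.
split => [fg [s t] Kst|fg i j iN jM s t si tj].
  have [i [j [iN jM si tj]]] := cell _ _ Kst.
  rewrite (fg i j iN jM s t si tj) /fold_map2 /= (fold_mapE hx iN si).
  by rewrite (fold_mapE hy jM tj) addrAC.
have Kst : K (s, t).
  have [i1 iN'] := andP iN; have [j1 jM'] := andP jM.
  have [s1 s2] := andP si; have [t1 t2] := andP tj.
  split; rewrite /= in_itv/=; apply/andP; split.
  - by rewrite (le_trans _ s1)// (net_le hx)//= (leq_trans (leq_pred _)).
  - by rewrite (le_trans s2)// (net_le hx)// iN' leqnn.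
  - by rewrite (le_trans _ t1)// (net_le hy)//= (leq_trans (leq_pred _)).
  - by rewrite (le_trans t2)// (net_le hy)// jM' leqnn.
by rewrite (fg _ Kst) /fold_map2 /= (fold_mapE hx iN si) (fold_mapE hy jM tj) addrAC.
Qed.

Let phic : continuous (phi : R * R -> R * R) := @fold_map2_continuous R x y N M.
Let phiK : forall z, K z -> K (phi z) := fold_map2_in hx N0 hy M0.

Lemma fractal_base_cont (f : Cont K R) :
  {within K, continuous (fun z => (f z : R) - (alpha z : R) * L f (phi z) : R^o)}.
Proof.
move=> z; apply: cvgB; first exact: (ContP f).1.
apply: cvgM; first exact: (ContP alpha).1.
exact: (within_comp phic phiK).
Qed.

Lemma fractal_opP f z : K z ->
  F f z = (f z : R) - (alpha z : R) * L f (phi z) + alpha z * F f (phi z).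
Proof.
have [q [q1 aq]] := supnorm_lt1.
have [g gE] := contraction_exists phic phiK aq q1 (Cont_restr (@fractal_base_cont f)).
have : is_alpha_fractal x N y M alpha L f (F f).
  apply: (@xgetPex _ 0 [set g | is_alpha_fractal x N y M alpha L f g]).
  exists g; apply/fractalP => w Kw.
  by rewrite gE// Cont_restr_in.
by move/fractalP; apply.
Qed.

Lemma fractal_op_uniq (f g : Cont K R) : (forall z, K z ->
    g z = (f z : R) - (alpha z : R) * L f (phi z) + alpha z * g (phi z)) ->
  F f = g.
Proof.
move=> gE; have [q [q1 aq]] := supnorm_lt1.
apply: (contraction_unique phiK aq q1 (f := Cont_restr (@fractal_base_cont f))).
  by move=> z Kz; rewrite fractal_opP// Cont_restr_in.
by move=> z Kz; rewrite gE// Cont_restr_in.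
Qed.

Lemma fractal_op_linear : linear F.
Proof.
move=> k f g; apply: fractal_op_uniq => z Kz.
have E (u v : Cont K R) w : (k *: u + v) w = k * u w + v w :> R by [].
rewrite linearP !E (fractal_opP f Kz) (fractal_opP g Kz).
ring.
Qed.

Variables (p : R) (p1 : 1 <= p).
Local Notation Nm h := ('N[mu]_p%:E [EFin \o h%R])%E.

(** Composition with the measure-preserving folding map is an L^p isometry, so the
    fixed point equation gives [||F f|| <= ||f|| + q C ||f|| + q ||F f||], where the
    last term is finite and can be moved to the left. *)
Lemma fractal_op_bounded : bounded_op (Cont_normR p) (Cont_normR p) L ->
  bounded_op (Cont_normR p) (Cont_normR p) F.
Proof.
move=> [C LC]; have [q [q1 aq]] := supnorm_lt1.
have q0 : 0 <= q by exact: le_trans (normr_ge0 _) (aq (0, 0)).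
exists ((1 + q * C) / (1 - q)) => f.
have mphi := @measurable_fold_map2 R x y N M.
have m (g : Cont K R) := measurable_Cont g.
have mc (g : Cont K R) : measurable_fun setT (fun z : T => g (phi z) : R).
  exact: (measurableT_comp (m g) mphi).
have ma (g : Cont K R) : measurable_fun setT (fun z : T => (alpha z : R) * g (phi z)).
  by apply: measurable_funM => //; exact: m.
have Na (g : Cont K R) :
    (Nm (fun z => (alpha z : R) * g (phi z)) <= q%:E * Cont_normR p g)%E.
  have := @Lnorm_fold_map2 _ x y N M hx N0 hy M0 p g (m g).
  rewrite /Cont_normR => <-.
  rewrite -(ger0_norm q0) -LnormMl//; last exact: mc.
  apply: le_Lnorm => //; first by apply: measurable_funM => //; exact: mc.
  by move=> z; rewrite !normrM (ger0_norm q0) ler_wpM2r.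
have FE z : F f z = (f z : R) - (alpha z : R) * L f (phi z) + alpha z * F f (phi z).
  have [Kz|Kz] := pselect (K z); first exact: fractal_opP.
  by rewrite !(Cont_out _ Kz) !mul0r subr0 addr0.
have m1 : measurable_fun setT (fun z : T => (f z : R) - (alpha z : R) * L f (phi z)).
  by apply: measurable_funB; [exact: m|exact: ma].
have h1 : (Cont_normR p (F f) <= Cont_normR p f + q%:E * Cont_normR p (L f)
    + q%:E * Cont_normR p (F f))%E.
  rewrite {1}/Cont_normR (_ : EFin \o F f = EFin \o ((fun z =>
    (f z : R) - (alpha z : R) * L f (phi z)) \+ (fun z => alpha z * F f (phi z)))%R);
    last by apply/funext => z; rewrite /= FE.
  apply: (le_trans (minkowski_EFin mu m1 (ma (F f)) p1)).
  apply: leeD; last exact: Na.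
  have := minkowski_EFin mu (m f)
    (measurableT_comp (@oppr_measurable R setT) (ma (L f))) p1.
  move=> /le_trans; apply; apply: leeD => //.
  rewrite (_ : EFin \o (-%R \o (fun z => (alpha z : R) * L f (phi z))) =
    (\- (EFin \o (fun z => ((alpha z : R) * L f (phi z))%R)))%E)//.
  by rewrite oppe_Lnorm; exact: Na.
have := LC f; move: h1.
rewrite -(fineK (Cont_normR_fin p1 f)) -(fineK (Cont_normR_fin p1 (F f))).
rewrite -(fineK (Cont_normR_fin p1 (L f))) -!EFinM -!EFinD !lee_fin.
set nf := fine (Cont_normR p f); set nL := fine (Cont_normR p (L f)).
set nF := fine (Cont_normR p (F f)) => h1 h2.
have h3 : q * nL <= q * (C * nf) by rewrite ler_wpM2l.
rewrite mulrAC ler_pdivlMr ?subr_gt0//.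
rewrite mulrDl mul1r mulrBr mulr1 lerBlDr (mulrC nF).
by apply: (le_trans h1); rewrite lerD2r lerD2l -mulrA.
Qed.
End fractal.

(** * Operator norms and complexification *)

Section opnorm_facts.
Variables (R : realType) (U V : Type) (nU : U -> \bar R) (nV : V -> \bar R).
Variable A : U -> V.

Lemma opnorm_le (k : R) : 0 <= k -> (forall u, (nV (A u) <= k%:E * nU u)%E) ->
  (opnorm nU nV A <= k%:E)%E.
Proof.
move=> k0 Ak; apply: ge_ereal_sup => _ [u /= u1 <-].
by apply: (le_trans (Ak u)); rewrite -[leRHS]mule1 lee_wpmul2l.
Qed.

Lemma opnorm_ub u : (nU u <= 1)%E -> (nV (A u) <= opnorm nU nV A)%E.
Proof. by move=> u1; apply: ereal_sup_ubound; exists u. Qed.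

Variable sU : R -> U -> U.
Hypothesis nU_fin : forall u, nU u \is a fin_num.
Hypothesis nU_ge0 : forall u, (0 <= nU u)%E.
Hypothesis nV_ge0 : forall v, (0 <= nV v)%E.
Hypothesis nU_scale : forall r u, 0 < r -> nU (sU r u) = (r%:E * nU u)%E.
Hypothesis nV_scale : forall r u, 0 < r -> nV (A (sU r u)) = (r%:E * nV (A u))%E.
Hypothesis A_bounded : bounded_op nU nV A.
Variable u0 : U.
Hypothesis u0_le1 : (nU u0 <= 1)%E.

Lemma opnorm_fin : exists k : R, 0 <= k /\ opnorm nU nV A = k%:E.
Proof.
have [M AM] := A_bounded.
have o0 : (0 <= opnorm nU nV A)%E by apply: le_trans (opnorm_ub u0_le1).
have oM : (opnorm nU nV A <= `|M|%:E)%E.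
  apply: opnorm_le => // u; apply: (le_trans (AM u)).
  by apply: lee_wpmul2r => //; rewrite lee_fin ler_norm.
have ofin : opnorm nU nV A \is a fin_num.
  by rewrite ge0_fin_numE//; apply: le_lt_trans oM (ltry _).
by exists (fine (opnorm nU nV A)); rewrite fineK// fine_ge0.
Qed.

(** Vectors of norm 0 cannot be rescaled to norm 1: for them the inequality comes from
    boundedness. The scaling [sU] is abstract so as to apply to spaces over the reals
    and over the complex numbers alike. *)
Lemma le_opnorm u : (nV (A u) <= opnorm nU nV A * nU u)%E.
Proof.
have [k [k0 kE]] := opnorm_fin; have [M AM] := A_bounded.
have [u_eq0|u_neq0] := eqVneq (nU u) 0%E.
  by have := AM u; rewrite u_eq0 !mule0.
have nE := fineK (nU_fin u).
have r0 : 0 < fine (nU u).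
  by rewrite -lte_fin nE lt0e u_neq0 nU_ge0.
have ri : 0 < (fine (nU u))^-1 by rewrite invr_gt0.
have : (nV (A (sU (fine (nU u))^-1 u)) <= opnorm nU nV A)%E.
  by apply: opnorm_ub; rewrite nU_scale// -{2}nE -EFinM mulVf// gt_eqF.
rewrite nV_scale// kE -nE muleC lee_pdivrMr//.
Qed.
End opnorm_facts.

Section complexify_facts.
Variables (R : realType) (a b c d : R).
Local Notation K := (rect a b c d).
Local Notation mu := (rect_measure a b c d).
Local Notation T := (measurableTypeR R * measurableTypeR R)%type.
Variables (p : R) (p1 : 1 <= p).
Implicit Types (f g : Cont K R) (h : Cont K R[i]).

Let p0 : 0 < p. Proof. exact: lt_le_trans p1. Qed.

(** A complex scalar acts on real and imaginary parts by real linear combinations,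
    with which [F] commutes. *)
Lemma complexify_linear (F : Cont K R -> Cont K R) : linear F -> linear (complexify F).
Proof.
move=> linF k f g.
have FB (s t : R) u v w : F (s *: u + (t *: v + w)) = s *: F u + (t *: F v + F w).
  by rewrite linF linF.
have -> : complexify F (k *: f + g) = Cont_complex
    (F (Re k *: Cont_Re f + ((- Im k) *: Cont_Im f + Cont_Re g)))
    (F (Re k *: Cont_Im f + (Im k *: Cont_Re f + Cont_Im g))).
  congr (Cont_complex (F _) (F _)); apply: Cont_ext => z.
    change (Re (k * f z + g z) = Re k * Re (f z) + (- Im k * Im (f z) + Re (g z))).
    by case: k (f z) (g z) => k1 k2 [f1 f2] [g1 g2] /=; ring.
  change (Im (k * f z + g z) = Re k * Im (f z) + (Im k * Re (f z) + Im (g z))).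
  by case: k (f z) (g z) => k1 k2 [f1 f2] [g1 g2] /=; ring.
rewrite !FB; apply: Cont_ext => z.
set u := F (Cont_Re f); set v := F (Cont_Im f).
set u' := F (Cont_Re g); set v' := F (Cont_Im g).
change (((Re k * u z + (- Im k * v z + u' z)) +i* (Re k * v z + (Im k * u z + v' z)))%C =
  k * (u z +i* v z)%C + (u' z +i* v' z)%C).
by case: k => k1 k2 /=; congr (_ +i* _)%C; ring.
Qed.

(** The left-hand side is [(s^2 + t^2)^(p/2)], hence at most
    [2^(p/2) max(|s|, |t|)^p]. *)
Lemma normc_powR_le (s t : R) :
  normc (s +i* t)%C `^ p <= 2 `^ (p / 2) * (`|s| `^ p + `|t| `^ p).
Proof.
wlog st : s t / `|s| <= `|t|.
  move=> H; have [st|ts] := lerP `|s| `|t|; first exact: (H s t st).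
  rewrite [X in _ * X]addrC; have := H t s (ltW ts).
  by rewrite /= [X in Num.sqrt X]addrC.
apply: (@le_trans _ _ (2 `^ (p / 2) * `|t| `^ p)); last first.
  by rewrite ler_wpM2l ?powR_ge0// lerDr powR_ge0.
have -> : 2 `^ (p / 2) = (Num.sqrt 2) `^ p :> R.
  by rewrite -powR12_sqrt// -powRrM mulrC.
rewrite -powRM ?sqrtr_ge0//; apply: ge0_ler_powR.
- exact: ltW.
- by rewrite nnegrE normc_ge0.
- by rewrite nnegrE mulr_ge0// sqrtr_ge0.
have st2 : s ^+ 2 <= t ^+ 2.
  rewrite -(real_normK (num_real s)) -(real_normK (num_real t)).
  by rewrite lerXn2r ?nnegrE.
have t2 : 0 <= 2 * t ^+ 2 by rewrite mulr_ge0// sqr_ge0.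
rewrite /= -(sqrtr_sqr t) -sqrtrM// (ler_sqrt _ t2).
by rewrite mulr_natl mulr2n lerD2r.
Qed.

(** Integrating the pointwise bound produces the constant: [2^(p/2) (C^p + C^p)] is
    the p-th power of [2^(1/2 + 1/p) C]. *)
Lemma Cont_normC_complex f g (C : R) : 0 <= C ->
  (Cont_normR p f <= C%:E)%E -> (Cont_normR p g <= C%:E)%E ->
  (Cont_normC p (Cont_complex f g) <= (2 `^ (2^-1 + p^-1) * C)%:E)%E.
Proof.
move=> C0 /(Lnorm_leP _ p1 _ C0) fC /(Lnorm_leP _ p1 _ C0) gC.
apply/(Lnorm_leP _ p1); first by rewrite mulr_ge0// powR_ge0.
have mf := measurable_normr_powR p (measurable_Cont f).
have mg := measurable_normr_powR p (measurable_Cont g).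
have mfg : measurable_fun setT (fun z => (`|f z : R| `^ p)%:E + (`|g z : R| `^ p)%:E)%E.
  exact: emeasurable_funD.
apply: (@le_trans _ _ (\int[mu]_z ((2 `^ (p / 2))%:E *
    ((`|f z : R| `^ p)%:E + (`|g z : R| `^ p)%:E)))%E).
  apply: ge0_le_integral => //.
  - apply: measurable_normr_powR; apply: measurable_normc; exact: measurable_Cont.
  - by apply: measurable_funeM.
  move=> z _; rewrite -EFinD -EFinM lee_fin ger0_norm ?normc_ge0//.
  exact: normc_powR_le.
rewrite ge0_integralZl_EFin ?powR_ge0//; last first.
  by move=> z _; rewrite adde_ge0// lee_fin powR_ge0.
rewrite ge0_integralD//; try by move=> z _; rewrite lee_fin powR_ge0.
have -> : (2 `^ (2^-1 + p^-1) * C) `^ p = 2 `^ (p / 2) * (C `^ p + C `^ p).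
  rewrite powRM ?powR_ge0// -powRrM mulrDl mulVf ?gt_eqF// powRD ?pnatr_eq0 ?implybT//.
  by rewrite powRr1// (mulrC 2^-1); ring.
rewrite EFinM EFinD; apply: lee_wpmul2l; first by rewrite lee_fin powR_ge0.
exact: leeD.
Qed.
End complexify_facts.

(** * The extension of the complexified fractal operator *)

Theorem theorem4p5 (R : realType) (N M : nat) (x y : nat -> R)
  (hN : (2 <= N)%N) (hM : (2 <= M)%N)
  (hx : forall i, (i < N)%N -> x i < x i.+1)
  (hy : forall j, (j < M)%N -> y j < y j.+1)
  (p : R) (p1 : 1 <= p)
  (alpha : Cont (net_rect x N y M) R)
  (halpha : (supnorm alpha < 1)%E)
  (L : {linear Cont (net_rect x N y M) R -> Cont (net_rect x N y M) R})
  (hLbounded : bounded_op (Cont_normR p) (Cont_normR p) L)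
  (hLid : (L : Cont (net_rect x N y M) R -> Cont (net_rect x N y M) R) <> id)
  (hLcorner : forall (f : Cont (net_rect x N y M) R) (i j : nat),
    i \in [:: 0%N; N] -> j \in [:: 0%N; M] -> L f (x i, y j) = f (x i, y j)) :
  let F := fractal_op x N y M alpha L in
  let FC := complexify F in
  exists Fbar : {linear Lp (net_measure x N y M) p1 ->
                        Lp (net_measure x N y M) p1},
    [/\ bounded_op Lp_norm Lp_norm Fbar,
        forall f : Cont (net_rect x N y M) R[i],
          Fbar (Cont_Lp p1 f) = Cont_Lp p1 (FC f),
        (opnorm (Cont_normR p) (Cont_normR p) F <=
           opnorm Lp_norm Lp_norm Fbar)%E,
        opnorm Lp_norm Lp_norm Fbar =
           opnorm (Cont_normC p) (Cont_normC p) FC &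
        (opnorm (Cont_normC p) (Cont_normC p) FC <=
           (2 `^ (2^-1 + p^-1))%:E *
             opnorm (Cont_normR p) (Cont_normR p) F)%E].
Proof.
move=> F FC.
have N0 : (0 < N)%N by exact: leq_trans hN.
have M0 : (0 < M)%N by exact: leq_trans hM.
have Flin : linear F := fractal_op_linear hx N0 hy M0 L halpha.
have Fbd := fractal_op_bounded hx N0 hy M0 halpha p1 hLbounded.
pose FL : {linear Cont (net_rect x N y M) R -> Cont (net_rect x N y M) R} :=
  HB.pack F (GRing.isLinear.Build _ _ _ _ F Flin).
pose FCL : {linear Cont (net_rect x N y M) R[i] -> Cont (net_rect x N y M) R[i]} :=
  HB.pack FC (GRing.isLinear.Build _ _ _ _ FC (complexify_linear Flin)).
pose iota : {linear Cont (net_rect x N y M) R[i] -> Lp (net_measure x N y M) p1} :=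
  HB.pack (Cont_Lp p1)
    (GRing.isLinear.Build _ _ _ _ (Cont_Lp p1) (@Cont_Lp_linear _ _ _ _ _ _ p1)).
have FZ r u : F (r *: u) = r *: F u by exact: (linearZ_LR FL).
have FCZ r u : FC (r *: u) = r *: FC u by exact: (linearZ_LR FCL).
have F_0 : F 0 = 0 by exact: (linear0 FL).
have F_scale (r : R) u : 0 < r ->
    Cont_normR p (F (r *: u)) = (r%:E * Cont_normR p (F u))%E.
  by move=> r0; rewrite FZ Cont_normR_scale// gtr0_norm.
have R_scale (r : R) (u : Cont (net_rect x N y M) R) : 0 < r ->
    Cont_normR p (r *: u) = (r%:E * Cont_normR p u)%E.
  by move=> r0; rewrite Cont_normR_scale// gtr0_norm.
have R_ge0 (u : Cont (net_rect x N y M) R) : (0 <= Cont_normR p u)%E.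
  exact: Lnorm_ge0.
have C_ge0 (u : Cont (net_rect x N y M) R[i]) : (0 <= Cont_normC p u)%E.
  exact: Lnorm_ge0.
have R0_le1 : (Cont_normR p (0%R : Cont (net_rect x N y M) R) <= 1)%E.
  have E0 : (0 : Cont (net_rect x N y M) R) = 0 *: 0 by rewrite scale0r.
  by rewrite E0 Cont_normR_scale// normr0 mul0e.
have [kF [kF0 kFE]] := opnorm_fin R_ge0 R_ge0 Fbd R0_le1.
have F_le := le_opnorm (Cont_normR_fin p1) R_ge0 R_ge0 R_scale F_scale Fbd R0_le1.
have FC_le h : (Cont_normC p (FC h) <=
    (2 `^ (2^-1 + p^-1) * kF)%:E * Cont_normC p h)%E.
  have nhE := fineK (Cont_normC_fin p1 h).
  have nh0 : 0 <= fine (Cont_normC p h) by rewrite fine_ge0.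
  rewrite -nhE -EFinM -mulrA; apply: Cont_normC_complex => //.
  - exact: mulr_ge0.
  - rewrite EFinM nhE -kFE; apply: (le_trans (F_le _)).
    by rewrite kFE lee_wpmul2l// Cont_normR_Re.
  - rewrite EFinM nhE -kFE; apply: (le_trans (F_le _)).
    by rewrite kFE lee_wpmul2l// Cont_normR_Im.
have FC_bd : bounded_op (Cont_normC p) (Cont_normC p) FC.
  by exists (2 `^ (2^-1 + p^-1) * kF).
have C_scale (r : R) (u : Cont (net_rect x N y M) R[i]) : 0 < r ->
    Cont_normC p ((r%:C)%C *: u) = (r%:E * Cont_normC p u)%E.
  move=> r0; rewrite -!(Lp_norm_Cont p1) -[Cont_Lp p1 _]/(iota _) linearZ.
  rewrite -!Lp_nrmE Lp_nrmZ EFinM; congr (_%:E * _)%E.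
  by rewrite /= expr0n addr0 sqrtr_sqr gtr0_norm.
have FC_scale (r : R) u : 0 < r ->
    Cont_normC p (FC ((r%:C)%C *: u)) = (r%:E * Cont_normC p (FC u))%E.
  by move=> r0; rewrite FCZ C_scale.
have C0_le1 : (Cont_normC p (0%R : Cont (net_rect x N y M) R[i]) <= 1)%E.
  rewrite -(Lp_norm_Cont p1) -[Cont_Lp p1 _]/(iota _) linear0 -Lp_nrmE.
  by rewrite -(scale0r 0) Lp_nrmZ normc0 mul0r.
have [k [k0 kE]] := opnorm_fin C_ge0 C_ge0 FC_bd C0_le1.
have FC_opnorm := le_opnorm (Cont_normC_fin p1) C_ge0 C_ge0 C_scale FC_scale FC_bd C0_le1.
have FC_k h : Lp_nrm ((iota \o FCL) h) <= k * Lp_nrm (iota h).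
  by rewrite -lee_fin EFinM !Lp_nrmE !Lp_norm_Cont -kE; exact: FC_opnorm.
have [Fbar [FbarE Fbar_le]] := bounded_linear_extension
  (@Lp_nrmD _ _ _ _ _ p1) (@Lp_nrmZ _ _ _ _ _ p1) (@Lp_nrm_eq0 _ _ _ _ _ p1)
  (@Lp_nrm_complete _ _ _ _ _ p1) (iota := iota) (T := iota \o FCL)
  (@Cont_Lp_dense _ _ _ _ _ _ p1) k0 FC_k.
have Fbar_k u : (Lp_norm (Fbar u) <= k%:E * Lp_norm u)%E.
  by rewrite -!Lp_nrmE -EFinM lee_fin.
have FbarC (f : Cont (net_rect x N y M) R[i]) :
  Fbar (Cont_Lp p1 f) = Cont_Lp p1 (FC f) := FbarE f.
have opE : opnorm Lp_norm Lp_norm Fbar = opnorm (Cont_normC p) (Cont_normC p) FC.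
  apply/eqP; rewrite eq_le; apply/andP; split; first by rewrite kE; exact: opnorm_le.
  apply: ge_ereal_sup => _ [u /= u1 <-].
  rewrite -!(Lp_norm_Cont p1) -FbarC; apply: opnorm_ub.
  by rewrite Lp_norm_Cont.
exists Fbar; split => //.
- by exists k.
- rewrite opE; apply: ge_ereal_sup => _ [f /= f1 <-].
  rewrite -Cont_normC_real//.
  have -> : Cont_complex (F f) 0 = FC (Cont_complex f 0).
    rewrite /FC /complexify; congr Cont_complex.
      by congr F; apply: Cont_ext.
    rewrite (_ : Cont_Im _ = 0) ?F_0//.
    exact: Cont_ext.
  by apply: opnorm_ub; rewrite Cont_normC_real.
- rewrite kFE -EFinM; apply: opnorm_le => //.
  by rewrite mulr_ge0// powR_ge0.
Qed.
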